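(* Let $d\ge2$. The anisotropic hyperbolic wrapped normal family $\{\mathrm{HWN}_d(\mu,\Sigma):(\mu,\Sigma)\in\mathbb H^d\times\mathcal S^{++}(d)\}$ is identifiable. That is, if $\mathrm{HWN}_d(\mu,\Sigma)=\mathrm{HWN}_d(\mu',\Sigma')$ as probability distributions on $\mathbb H^d$, with $\mu,\mu'\in\mathbb H^d$ and $\Sigma,\Sigma'\in\mathcal S^{++}(d)$, then $\mu=\mu'$ and $\Sigma=\Sigma'$.
   Context: Hyperbolic space (Lorentz model): for $x,y\in\mathbb R^{d+1}$ let $\langle x,y\rangle_L=-x_0y_0+\sum_{j=1}^d x_jy_j$, and $\mathbb H^d=\{x\in\mathbb R^{d+1}:\langle x,x\rangle_L=-1,\ x_0>0\}$ with the Riemannian metric induced by $\langle\cdot,\cdot\rangle_L$ on tangent spaces. Let $o=(1,0,\dots,0)$. $\operatorname{Exp}_\mu:T_\mu\mathbb H^d\to\mathbb H^d$ is the Riemannian exponential map, and $PT_{x\to y}:T_x\mathbb H^d\to T_y\mathbb H^d$ is parallel transport along the unique geodesic from $x$ to $y$. $T_o\mathbb H^d$ is identified with $\mathbb R^d$ by $(0,v)\leftrightarrow v$. $\mathcal S^{++}(d)$ is the set of real symmetric positive definite $d\times d$ matrices. Definition: for $\mu\in\mathbb H^d$ and $\Sigma\in\mathcal S^{++}(d)$, $\mathrm{HWN}_d(\mu,\Sigma)$ is the law of $X=\operatorname{Exp}_\mu(PT_{o\to\mu}Z)$ where $Z\sim N_d(0,\Sigma)$. *)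

(* Defs.v *)
From HB Require Import structures.
From mathcomp Require Import all_boot all_order all_algebra.
From mathcomp Require Import all_classical all_reals all_analysis.

Set Implicit Arguments.
Unset Strict Implicit.
Unset Printing Implicit Defensive.

Import Order.TTheory GRing.Theory Num.Theory.
Import numFieldNormedType.Exports.

Local Open Scope classical_set_scope.
Local Open Scope ring_scope.

Section lorentz_model.
Context {R : realType} {d : nat}.
Implicit Types (x y mu v w : 'rV[R]_d.+1) (g V : R -> 'rV[R]_d.+1).

Definition lorentz x y : R :=
  - (x 0 ord0 * y 0 ord0) + \sum_(j < d) x 0 (lift ord0 j) * y 0 (lift ord0 j).

Definition hyperboloid : set 'rV[R]_d.+1 :=
  [set x | lorentz x x = -1 /\ 0 < x 0 ord0].

Definition origin : 'rV[R]_d.+1 := delta_mx 0 ord0.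

Definition tangent x : set 'rV[R]_d.+1 := [set v | lorentz x v = 0].

(* The Lorentz-orthogonal projection onto the tangent space at x; the normal
   line at x is spanned by x, and <x, x> = -1, whence the sign. *)
Definition tangent_proj x w : 'rV[R]_d.+1 := w + lorentz x w *: x.

(* The Levi-Civita connection of the metric induced on a submanifold is the
   tangential part of the flat connection of the ambient space, so the covariant
   derivative along g of a field V tangent to the hyperboloid is
   tangent_proj (g t) ('D_1 V t). *)
Definition parallel_along g V : Prop := forall t : R,
  [/\ tangent (g t) (V t), derivable V t 1 & tangent_proj (g t) ('D_1 V t) = 0].

(* Hyperbolic space is complete, so its geodesics are taken on all of R. *)
Definition geodesic g : Prop :=
  (forall t : R, hyperboloid (g t) /\ derivable g t 1)
  /\ parallel_along g ('D_1 g).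

(* For mu in the hyperboloid and v tangent at mu (resp. x, y in the hyperboloid
   and v tangent at x) the set below is a singleton; get picks its element. *)
Definition Exp mu v : 'rV[R]_d.+1 :=
  get [set y | exists g, [/\ geodesic g, g 0 = mu, 'D_1 g 0 = v & g 1 = y]].

Definition PT x y v : 'rV[R]_d.+1 :=
  get [set w | exists g V, [/\ geodesic g, g 0 = x & g 1 = y] /\
                           [/\ parallel_along g V, V 0 = v & V 1 = w]].

End lorentz_model.
Arguments hyperboloid {R d}.
Arguments origin {R d}.

Section cons_measure.
Local Open Scope ereal_scope.
Context d (T : measurableType d) (R : realType) (n : nat).
Variables (m1 : {sigma_finite_measure set T -> \bar R})
          (m2 : {sigma_finite_measure set (n.-tuple T) -> \bar R}).

Let tcons (p : T * n.-tuple T) : n.+1.-tuple T := [tuple of p.1 :: p.2].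

Let tuncons (t : n.+1.-tuple T) : T * n.-tuple T :=
  (thead t, [tuple of behead t]).

Let measurable_tcons : measurable_fun setT tcons.
Proof. exact: measurable_cons. Qed.

Let measurable_tuncons : measurable_fun setT tuncons.
Proof.
apply/measurable_fun_pairP; split; first exact: measurable_tnth.
exact: measurable_behead.
Qed.

Let tconsK : cancel tcons tuncons.
Proof.
by move=> [x t]; rewrite /tuncons theadE; congr pair; exact/val_inj.
Qed.

(* The product of m1 and m2, carried over to (n+1)-tuples. *)
Definition cons_measure : set (n.+1.-tuple T) -> \bar R :=
  pushforward (m1 \x m2) tcons.

Let cons_measure0 : cons_measure set0 = 0.
Proof. by rewrite /cons_measure /pushforward preimage_set0 measure0. Qed.

Let cons_measure_ge0 A : 0 <= cons_measure A.
Proof. exact: measure_ge0. Qed.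

Let cons_measure_sigma_additive : semi_sigma_additive cons_measure.
Proof.
move=> F mF tF mUF; rewrite /cons_measure /pushforward preimage_bigcup.
apply: measure_semi_sigma_additive.
- by move=> i; rewrite -[X in measurable X]setTI; exact: measurable_tcons.
- apply/trivIsetP => /= i j _ _ ij; rewrite -preimage_setI.
  by move/trivIsetP : tF => /(_ _ _ _ _ ij) ->//; rewrite preimage_set0.
- rewrite -preimage_bigcup -[X in measurable X]setTI.
  exact: measurable_tcons.
Qed.

HB.instance Definition _ := isMeasure.Build _ _ _ cons_measure
  cons_measure0 cons_measure_ge0 cons_measure_sigma_additive.

Let sigma_finite_cons_measure : sigma_finite setT cons_measure.
Proof.
have /sigma_finiteP[F [TF ndF Foo]] := sigma_finiteT m1.
have /sigma_finiteP[G [TG ndG Goo]] := sigma_finiteT m2.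
exists (fun i => tuncons @^-1` (F i `*` G i)).
  rewrite -preimage_bigcup (_ : \bigcup_i _ = setT) ?preimage_setT//.
  rewrite -subTset => -[x y] _.
  have [i _ Fix] : (\bigcup_i F i) x by rewrite -TF.
  have [j _ Gjy] : (\bigcup_i G i) y by rewrite -TG.
  exists (maxn i j) => //; split.
    by move: x Fix; exact/subsetPset/ndF/leq_maxl.
  by move: y Gjy; exact/subsetPset/ndG/leq_maxr.
move=> i; have [mF Fi] := Foo i; have [mG Gi] := Goo i; split.
  rewrite -[X in measurable X]setTI.
  by apply: measurable_tuncons => //; exact: measurableX.
rewrite /cons_measure /pushforward -comp_preimage.
rewrite (_ : _ \o _ = id); last by apply/funext => p /=; rewrite tconsK.
by rewrite preimage_id product_measure1E// lte_mul_pinfty// ge0_fin_numE.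
Qed.

HB.instance Definition _ := Measure_isSigmaFinite.Build _ _ _ cons_measure
  sigma_finite_cons_measure.

End cons_measure.

Section gaussian.
Context {R : realType}.
Local Notation RT := (measurableTypeR R).

(* Lebesgue measure on R^n as the n-fold product of lebesgue_measure, on n-tuples
   because the library equips them with the product sigma-algebra. *)
Fixpoint lebesgue_tuple n :
    {sigma_finite_measure set (n.-tuple RT) -> \bar R} :=
  if n is n'.+1 then cons_measure (@lebesgue_measure R) (lebesgue_tuple n')
  else @dirac _ _ [tuple] R.

Variable d : nat.
Implicit Types (Sigma : 'M[R]_d) (z : d.-tuple RT).

Definition row_of_tuple z : 'rV[R]_d := \row_j tnth z j.

Definition spd : set 'M[R]_d :=
  [set Sigma | Sigma^T = Sigma /\
     forall v : 'rV_d, v != 0 -> 0 < (v *m Sigma *m v^T) 0 0].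

(* Vectors are rows, so the quadratic form of Sigma^-1 is z Sigma^-1 z^T. *)
Definition normal_tuple_pdf Sigma z : R :=
  (Num.sqrt ((pi *+ 2) ^+ d * \det Sigma))^-1 *
  expR (- ((row_of_tuple z *m invmx Sigma *m (row_of_tuple z)^T) 0 0 / 2)).

Definition normal_tuple Sigma (A : set (d.-tuple RT)) : \bar R :=
  (\int[lebesgue_tuple d]_(z in A) (normal_tuple_pdf Sigma z)%:E)%E.

Definition tangent_origin z : 'rV[R]_d.+1 := row_mx (0 : 'rV_1) (row_of_tuple z).

(* R^(d+1) with its Borel sigma-algebra. *)
Definition ambient := g_sigma_algebraType (@open 'rV[R]_d.+1).

(* A Borel measure on R^(d+1), concentrated on the hyperboloid when mu lies on it.
   The hyperboloid is closed, so its Borel sets are the Borel sets of R^(d+1)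
   included in it, and the distribution on hyperbolic space is the restriction
   of HWN mu Sigma to those. *)
Definition HWN (mu : 'rV[R]_d.+1) Sigma : set ambient -> \bar R :=
  pushforward (normal_tuple Sigma)
    (fun z => Exp mu (PT origin mu (tangent_origin z)) : ambient).

End gaussian.
Arguments spd {R d}.

(* Main.v *)
Require Import Defs.
From mathcomp Require Import all_boot all_order all_algebra.
From mathcomp Require Import all_classical all_reals all_analysis.
From mathcomp Require Import measurable_realfun ring lra.
Set Implicit Arguments.
Unset Strict Implicit.
Unset Printing Implicit Defensive.
Import Order.TTheory GRing.Theory Num.Theory.
Import numFieldNormedType.Exports.
Local Open Scope classical_set_scope.
Local Open Scope ring_scope.

(* The point reflection of the hyperboloid in mu sends the wrapped image of z to
   that of -z, so HWN(mu, Sigma) is invariant under it. If the laws for mu and mu'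
   agree, they are invariant under both reflections, hence under their composite,
   which for mu <> mu' rescales a null vector n by some c in (0, 1). The law of
   <n, X> is then invariant under scaling, so that some slab {t <= <n, X> < t / c}
   with nonempty interior is null although the density is positive, a
   contradiction. With mu = mu', the Gaussian densities of Sigma and Sigma' can
   be compared on the preimages of hyperbolic balls around mu, which yields equal
   normalising constants, and then on the cone where the quadratic form of
   Sigma^-1 - Sigma'^-1 is negative, which must be empty. *)

(** * Hyperbolic functions *)

Section hyperbolic_functions.
Context {R : realType}.
Implicit Types x y k t : R.

(** [Exp] and [PT] are picked by [get] among solutions of differential equations, so nothing can be
    computed before existence and uniqueness are known. In ambient coordinates the equations become
    [g'' = k^2 g] and [V' = <g', V> g] with [k] and [<g', V>] constant along [g], which yields
    closed forms in [cosh] and [sinh]. These contain [sinh k / k], which is 0 at [k = 0] because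
    [0^-1 = 0]; hence the recurring side condition that the velocity vanishes when [k = 0]. No
    density on the hyperboloid is formed: each test set is a sublevel set of a Borel function,
    pulled back through [wrap] to a Gaussian integral over tuples, so that no Jacobian enters. A
    null vector [n] serves because [<n, x>] never vanishes on the hyperboloid: each of its values is
    moved strictly by the scaling. The normalising constants are compared before the quadratic forms
    because the sign of the difference of exponents decides which density is larger only once the
    constants agree. *)

Definition cosh x : R := (expR x + expR (- x)) / 2.
Definition sinh x : R := (expR x - expR (- x)) / 2.

Lemma cosh0 : cosh 0 = 1.
Proof. by rewrite /cosh oppr0 expR0; field. Qed.

Lemma sinh0 : sinh 0 = 0.
Proof. by rewrite /sinh oppr0 subrr mul0r. Qed.

Lemma cosh2_sinh2 x : cosh x ^+ 2 - sinh x ^+ 2 = 1.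
Proof.
rewrite /cosh /sinh expRN; have := expR_gt0 x.
by move=> /lt0r_neq0 e0; field.
Qed.

Lemma sinh2E x : sinh x ^+ 2 = cosh x ^+ 2 - 1.
Proof. by have := cosh2_sinh2 x; lra. Qed.

Lemma cosh_gt0 x : 0 < cosh x.
Proof. by rewrite divr_gt0// addr_gt0// expR_gt0. Qed.

Lemma sinh_gt0 x : 0 < x -> 0 < sinh x.
Proof. by move=> x0; rewrite divr_gt0// subr_gt0 ltr_expR; lra. Qed.

Lemma ltr_cosh x y : 0 <= x -> 0 <= y -> (cosh x < cosh y) = (x < y).
Proof.
wlog suff : / forall u v : R, 0 <= u -> u < v -> cosh u < cosh v.
  move=> H x0 y0; have [xy|yx|->] := ltgtP x y; last by rewrite ltxx.
    exact: H.
  by apply/negbTE; rewrite -leNgt ltW// H.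
move=> {x y} u v u0 uv; rewrite -subr_gt0.
have eu : 1 <= expR u by rewrite -(@expR0 R) ler_expR.
have ev : expR u < expR v by rewrite ltr_expR.
have -> : cosh v - cosh u =
    (expR v - expR u) * (expR u * expR v - 1) / (expR u * expR v) / 2.
  by rewrite /cosh !expRN; field; rewrite !gt_eqF ?expR_gt0.
rewrite !divr_gt0 ?mulr_gt0 ?expR_gt0 ?subr_gt0//.
by rewrite (lt_le_trans (le_lt_trans eu ev))// ler_peMl// expR_ge0.
Qed.

Lemma cosh_surj x : 1 <= x -> exists2 k, 0 <= k & cosh k = x.
Proof.
move=> x1; pose s := Num.sqrt (x ^+ 2 - 1).
have s2 : s ^+ 2 = x ^+ 2 - 1 by rewrite sqr_sqrtr// subr_ge0 expr_ge1//; lra.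
have s0 : 0 <= s by exact: sqrtr_ge0.
have xs : 1 <= x + s by lra.
(* This is arcosh: [x + s] and [x - s] are mutually inverse. *)
exists (ln (x + s)); first exact: ln_ge0.
rewrite /cosh expRN lnK ?posrE; last by lra.
have xs0 : x + s != 0 by lra.
suff -> : (x + s)^-1 = x - s by lra.
by apply: (mulfI xs0); rewrite divff//; lra.
Qed.

Lemma is_derive_expR_scale k t :
  is_derive t 1 (fun s : R => expR (k * s)) (k * expR (k * t)).
Proof.
have h : is_derive t 1 (fun s : R => k * s) k.
  by apply: is_derive_eq; rewrite /GRing.scale/= mulr1.
have := is_derive1_comp (is_derive_expR (k * t)) h.
by rewrite mulrC.
Qed.

Lemma is_derive_cosh k t :
  is_derive t 1 (fun s => cosh (k * s)) (k * sinh (k * t)).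
Proof.
have -> : (fun s => cosh (k * s)) =
    (2^-1 : R) *: ((fun s => expR (k * s)) + (fun s => expR ((- k) * s))).
  by apply/funext => s; rewrite /cosh -mulNr mulrC.
have e1 := is_derive_expR_scale k t; have e2 := is_derive_expR_scale (- k) t.
apply: is_derive_eq.
by rewrite /sinh /GRing.scale/= !mulNr; ring.
Qed.

Lemma is_derive_sinh k t :
  is_derive t 1 (fun s => sinh (k * s)) (k * cosh (k * t)).
Proof.
have -> : (fun s => sinh (k * s)) =
    (2^-1 : R) *: ((fun s => expR (k * s)) - (fun s => expR ((- k) * s))).
  by apply/funext => s; rewrite /sinh -mulNr mulrC.
have e1 := is_derive_expR_scale k t; have e2 := is_derive_expR_scale (- k) t.
apply: is_derive_eq.
by rewrite /cosh /GRing.scale/= !mulNr; ring.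
Qed.

(* With [0^-1 = 0] the last term vanishes at [k = 0], where [f1 0 = 0] makes [f]
   constant. *)
Lemma ode_cosh_sinh k (f f1 : R -> R) : (k = 0 -> f1 0 = 0) ->
  (forall t, is_derive t 1 f (f1 t)) ->
  (forall t, is_derive t 1 f1 (k ^+ 2 * f t)) ->
  forall t, f t = cosh (k * t) * f 0 + sinh (k * t) / k * f1 0.
Proof.
move=> f10 df df1 t; have [k0|k0] := eqVneq k 0.
  rewrite k0 mul0r cosh0 sinh0 mul1r mul0r mul0r addr0.
  have f1c s : f1 s = 0.
    rewrite -(f10 k0); apply: is_derive_0_is_cst => u.
    by have := df1 u; rewrite k0 expr0n mul0r.
  by apply: is_derive_0_is_cst => u; have := df u; rewrite f1c.
(* A first integral for each root [c] of [c^2 = k^2]; the roots [k] and [-k] together determine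
   [f t]. *)
have const c : c ^+ 2 = k ^+ 2 ->
    (f1 t + c * f t) * expR (- (c * t)) = f1 0 + c * f 0.
  move=> ck; pose h s := (f1 s + c * f s) * expR ((- c) * s).
  transitivity (h t); first by rewrite /h mulNr.
  rewrite (_ : f1 0 + c * f 0 = h 0); last by rewrite /h mulr0 expR0 mulr1.
  apply: is_derive_0_is_cst => u.
  have e1 := is_derive_expR_scale (- c) u.
  have e2 := df u; have e3 := df1 u.
  apply: (is_derive_eq (is_deriveM (is_deriveD e3 (is_deriveZ c e2)) e1)).
  change ((f1 u + c * f u) * (- c * expR (- c * u)) +
    expR (- c * u) * (k ^+ 2 * f u + c * f1 u) = 0).
  by rewrite -ck; ring.
have := const k erefl; have := const (- k) (sqrrN k).
rewrite !mulNr opprK /cosh /sinh expRN => H1 H2.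
have E0 := lt0r_neq0 (expR_gt0 (k * t)).
have H3 : f1 t + k * f t = (f1 0 + k * f 0) * expR (k * t).
  by rewrite -H2 mulfVK.
have H4 : f1 t - k * f t = (f1 0 - k * f 0) / expR (k * t).
  by rewrite -H1 mulfK.
have -> : f t = ((f1 t + k * f t) - (f1 t - k * f t)) / (2 * k) by field.
by rewrite H3 H4; field; rewrite k0.
Qed.

End hyperbolic_functions.

(** * The Lorentz form *)

Section lorentz_form.
Context {R : realType} {d : nat}.
Implicit Types (x y u v w : 'rV[R]_d.+1) (c : R).

Lemma lorentzC x y : lorentz x y = lorentz y x.
Proof.
rewrite /lorentz mulrC; congr (_ + _).
by apply: eq_bigr => j _; rewrite mulrC.
Qed.

Lemma lorentzDr x y w : lorentz x (y + w) = lorentz x y + lorentz x w.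
Proof.
rewrite /lorentz mxE mulrDr opprD addrACA; congr (_ + _).
by rewrite -big_split; apply: eq_bigr => j _; rewrite mxE mulrDr.
Qed.

Lemma lorentzZr c x y : lorentz x (c *: y) = c * lorentz x y.
Proof.
rewrite /lorentz mxE mulrDr mulrCA mulrN; congr (_ + _).
by rewrite mulr_sumr; apply: eq_bigr => j _; rewrite mxE mulrCA.
Qed.

Lemma lorentzNr x y : lorentz x (- y) = - lorentz x y.
Proof. by rewrite -scaleN1r lorentzZr mulN1r. Qed.

Lemma lorentzBr x y w : lorentz x (y - w) = lorentz x y - lorentz x w.
Proof. by rewrite lorentzDr lorentzNr. Qed.

Lemma lorentz0r x : lorentz x 0 = 0.
Proof. by rewrite -(scale0r 0) lorentzZr mul0r. Qed.

Lemma lorentzDl x y w : lorentz (x + y) w = lorentz x w + lorentz y w.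
Proof. by rewrite lorentzC lorentzDr !(lorentzC w). Qed.

Lemma lorentzZl c x y : lorentz (c *: x) y = c * lorentz x y.
Proof. by rewrite lorentzC lorentzZr lorentzC. Qed.

Lemma lorentzNl x y : lorentz (- x) y = - lorentz x y.
Proof. by rewrite lorentzC lorentzNr lorentzC. Qed.

Definition lorentzE := (lorentzDr, lorentzDl, lorentzNr, lorentzNl,
  lorentzZr, lorentzZl).

Lemma lorentz_originl x : lorentz origin x = - x 0 ord0.
Proof.
rewrite /lorentz /origin mxE !eqxx mul1r big1 ?addr0// => j _.
by rewrite mxE eqxx eq_sym (negbTE (neq_lift _ _)) mul0r.
Qed.

Lemma origin_hyperboloid : hyperboloid (origin : 'rV[R]_d.+1).
Proof. by split; rewrite ?lorentz_originl /origin mxE !eqxx. Qed.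

Lemma row_lift_eq x y : x 0 ord0 = y 0 ord0 ->
  (forall j, x 0 (lift ord0 j) = y 0 (lift ord0 j)) -> x = y.
Proof.
move=> xy0 xy; apply/rowP => i; case: (unliftP ord0 i) => [j|] ->//.
Qed.

(* Expanding the square of [x_j y_0 - y_j x_0]. *)
Lemma sum_sqr_lorentz x y :
  \sum_(j < d) (x 0 (lift ord0 j) * y 0 ord0 - y 0 (lift ord0 j) * x 0 ord0) ^+ 2
  = y 0 ord0 ^+ 2 * lorentz x x + x 0 ord0 ^+ 2 * lorentz y y
    - 2 * (x 0 ord0 * y 0 ord0) * lorentz x y.
Proof.
rewrite /lorentz.
set a := x 0 ord0; set b := y 0 ord0.
transitivity (\sum_(j < d) (b ^+ 2 * (x 0 (lift ord0 j) * x 0 (lift ord0 j)) +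
   (a ^+ 2 * (y 0 (lift ord0 j) * y 0 (lift ord0 j)) +
   (- (2 * (a * b))) * (x 0 (lift ord0 j) * y 0 (lift ord0 j))))).
  by apply: eq_bigr => j _; ring.
by rewrite !big_split/= -!mulr_sumr; ring.
Qed.

(** Reversed Cauchy-Schwarz: the sum of squares equals [- (x_0 - y_0)^2 - 2 x_0 y_0 (<x, y> + 1)],
    which would be negative if [<x, y> > -1]. *)
Lemma lorentz_le_N1 x y : hyperboloid x -> hyperboloid y -> lorentz x y <= -1.
Proof.
move=> [xx x0] [yy y0]; have := sum_sqr_lorentz x y; rewrite xx yy.
set s := \sum_(j < d) _; have : 0 <= s by apply: sumr_ge0 => j _; exact: sqr_ge0.
move=> s0 sE; rewrite leNgt; apply/negP => xy.
have := mulr_gt0 (mulr_gt0 x0 y0) (_ : 0 < lorentz x y + 1); rewrite -subr_gt0.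
by have := sqr_ge0 (x 0 ord0 - y 0 ord0); lra.
Qed.

Lemma lorentz_eq_N1 x y : hyperboloid x -> hyperboloid y ->
  lorentz x y = -1 -> x = y.
Proof.
move=> [xx x0] [yy y0] xy.
have := sum_sqr_lorentz x y; rewrite xx yy xy.
set s := \sum_(j < d) _ => sE.
have s_ge0 : 0 <= s by apply: sumr_ge0 => j _; exact: sqr_ge0.
have sE' : s = - (x 0 ord0 - y 0 ord0) ^+ 2 by rewrite sE; ring.
have e0 : x 0 ord0 = y 0 ord0.
  apply/eqP; rewrite -subr_eq0 -sqrf_eq0; apply/eqP.
  by have := sqr_ge0 (x 0 ord0 - y 0 ord0); lra.
have s0 : s = 0 by rewrite sE' e0 subrr expr0n oppr0.
apply: row_lift_eq => // j.
have /eqP := s0; rewrite psumr_eq0; last by move=> i _; exact: sqr_ge0.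
move=> /allP/(_ j (mem_index_enum _)); rewrite sqrf_eq0 e0 -mulrBl mulf_eq0.
by rewrite (gt_eqF y0) orbF subr_eq0 => /eqP.
Qed.

(** The form is positive definite on the orthogonal complement of a timelike vector: with
    [<x, y> = 0] the sum of squares collapses to [- y_0^2]. *)
Lemma null_lorentz_neq0 x y : hyperboloid x -> lorentz y y = 0 -> y != 0 ->
  lorentz x y != 0.
Proof.
move=> [xx x0] yy; apply: contraNneq => xy.
have := sum_sqr_lorentz x y; rewrite xx yy xy.
set s := \sum_(j < d) _ => sE.
have s_ge0 : 0 <= s by apply: sumr_ge0 => j _; exact: sqr_ge0.
have y0 : y 0 ord0 = 0.
  apply/eqP; rewrite -sqrf_eq0; apply/eqP.
  by have := sqr_ge0 (y 0 ord0); lra.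
have s0 : s = 0 by rewrite sE y0 expr0n/=; ring.
apply/eqP/row_lift_eq => [|j]; first by rewrite y0 mxE.
have /eqP := s0; rewrite psumr_eq0; last by move=> i _; exact: sqr_ge0.
move=> /allP/(_ j (mem_index_enum _)); rewrite sqrf_eq0 y0 mulr0 sub0r oppr_eq0.
by rewrite mulf_eq0 (gt_eqF x0) orbF mxE => /eqP.
Qed.

End lorentz_form.

(** * Geodesics and parallel transport *)

Section geodesics.
Context {R : realType} {d : nat}.
Implicit Types (x y u v w : 'rV[R]_d.+1) (g h V : R -> 'rV[R]_d.+1) (k t : R).

Lemma is_derive_rowP n (g : R -> 'rV[R]_n) t (dg : 'rV[R]_n) :
  is_derive t 1 g dg <-> forall i, is_derive t 1 (fun s => g s 0 i) (dg 0 i).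
Proof.
split=> [gdg i|gdg].
  have [dgt dgE] := gdg; split; first by have /derivable_mxP := dgt; exact.
  by rewrite -dgE derive_mx// mxE.
have dgt : derivable g t 1.
  by apply/derivable_mxP => i j; rewrite ord1; have [] := gdg j.
split=> //; rewrite derive_mx//; apply/rowP => j; rewrite mxE.
by have [] := gdg j.
Qed.

Lemma is_derive_scale_cst n (f : R -> R) t (df : R) (v : 'rV[R]_n) :
  is_derive t 1 f df -> is_derive t 1 (fun s => f s *: v) (df *: v).
Proof.
move=> fdf; apply/is_derive_rowP => i.
rewrite (_ : (fun s => _) = v 0 i *: f); last first.
  by apply/funext => s; rewrite mxE mulrC.
by apply: (is_derive_eq (is_deriveZ (v 0 i) fdf)); rewrite mxE mulrC.
Qed.

Lemma is_derive_lorentz g h t u v : is_derive t 1 g u -> is_derive t 1 h v ->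
  is_derive t 1 (fun s => lorentz (g s) (h s)) (lorentz u (h t) + lorentz (g t) v).
Proof.
move=> /is_derive_rowP gu /is_derive_rowP hv.
pose p i : R -> R := (fun s => g s 0 i) * (fun s => h s 0 i).
have dp i : is_derive t 1 (p i) (u 0 i * h t 0 i + g t 0 i * v 0 i).
  apply: (is_derive_eq (is_deriveM (gu i) (hv i))).
  change (g t 0 i * v 0 i + h t 0 i * u 0 i = u 0 i * h t 0 i + g t 0 i * v 0 i).
  by ring.
have -> : (fun s => lorentz (g s) (h s)) =
    - p ord0 + \sum_(j < d) p (lift ord0 j).
  by apply/funext => s; rewrite /lorentz fctE fct_sumE.
apply: (is_derive_eq (is_deriveD (is_deriveN (dp ord0))
  (is_derive_sum (fun j => dp (lift ord0 j))))).
by rewrite /lorentz big_split/=; ring.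
Qed.

Lemma is_derive_row_cst n (g : R -> 'rV[R]_n) :
  (forall t, is_derive t 1 g 0) -> forall s t, g s = g t.
Proof.
move=> g0 s t; apply/rowP => i.
apply: (@is_derive_0_is_cst _ (fun s => g s 0 i)) => r.
by have /is_derive_rowP/(_ i) := g0 r; rewrite mxE.
Qed.

Lemma tangent_speed x v : hyperboloid x -> tangent x v ->
  exists2 k, lorentz v v = k ^+ 2 & (k = 0 -> v = 0).
Proof.
move=> hx; have [xx x0] := hx; rewrite /tangent/= => xv.
have vv : 0 <= lorentz v v.
  have := sum_sqr_lorentz x v; rewrite xx xv mulr0 subr0.
  set s := \sum_(j < d) _ => sE.
  have s0 : 0 <= s by apply: sumr_ge0 => j _; exact: sqr_ge0.
  rewrite -(@pmulr_rge0 _ (x 0 ord0 ^+ 2)) ?exprn_gt0//.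
  by have := sqr_ge0 (v 0 ord0); lra.
exists (Num.sqrt (lorentz v v)); first by rewrite sqr_sqrtr.
move=> k0; apply/eqP; apply: contraTT isT => v0.
have := null_lorentz_neq0 hx _ v0; rewrite xv eqxx; apply.
by rewrite -(sqr_sqrtr vv) k0 expr0n.
Qed.

(** Of the two sheets of [<y, y> = -1], the lower one is excluded because there [- y] lies on the
    upper sheet, which forces [<x, y> >= 1]. *)
Lemma hyperboloid_lorentz_lt0 x y : hyperboloid x -> lorentz y y = -1 ->
  lorentz x y < 0 -> hyperboloid y.
Proof.
move=> hx yy xy; split=> //; rewrite ltNge; apply/negP; rewrite le_eqVlt.
move=> /predU1P[y0|y0].
  move: yy; rewrite /lorentz y0 mul0r oppr0 add0r => yy.
  suff : 0 <= (-1 : R) by rewrite oppr_ge0 ler10.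
  by rewrite -yy; apply: sumr_ge0 => j _; rewrite -expr2 sqr_ge0.
suff : hyperboloid (- y).
  by move=> /(lorentz_le_N1 hx); rewrite lorentzNr; lra.
by split; rewrite ?lorentzE ?opprK// mxE oppr_gt0.
Qed.

(** Parallelism makes the derivative of [V] normal, that is, a multiple of [g]; differentiating
    [<g, V> = 0] gives the coefficient. *)
Lemma parallel_along_is_derive g V : geodesic g -> parallel_along g V ->
  forall t, is_derive t 1 V (lorentz ('D_1 g t) (V t) *: g t).
Proof.
move=> [gH _] pV t; have [_ dg] := gH t; have [tV dV] := pV t.
rewrite /tangent_proj => /eqP; rewrite addr_eq0 => /eqP VE.
have gg1 := derivableP dg; have VV1 := derivableP dV.
have : is_derive t 1 (fun s => lorentz (g s) (V s)) 0.
  rewrite (_ : (fun s => _) = cst 0); first exact: is_derive_cst.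
  by apply/funext => s; have [] := pV s.
move=> d0; have := is_derive_lorentz gg1 VV1.
move=> /@derive_val; rewrite (@derive_val _ _ _ _ _ _ _ d0) => /esym/eqP.
by rewrite addr_eq0 => /eqP ->; rewrite scaleNr -VE.
Qed.

Lemma parallel_along_lorentz_cst g V W : geodesic g -> parallel_along g V ->
  parallel_along g W -> forall t, lorentz (V t) (W t) = lorentz (V 0) (W 0).
Proof.
move=> geo pV pW t.
apply: (@is_derive_0_is_cst _ (fun s => lorentz (V s) (W s))) => r.
have dV := parallel_along_is_derive geo pV r.
have dW := parallel_along_is_derive geo pW r.
apply: (is_derive_eq (is_derive_lorentz dV dW)).
have [tV _ _] := pV r; have [tW _ _] := pW r; rewrite /tangent/= in tV tW.
by rewrite !lorentzE (lorentzC (V r)) tV tW !mulr0 addr0.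
Qed.

Section solution.
Variables (g : R -> 'rV[R]_d.+1) (k : R).
Hypotheses (geo : geodesic g) (speed : lorentz ('D_1 g 0) ('D_1 g 0) = k ^+ 2).
Hypothesis (k0 : k = 0 -> 'D_1 g 0 = 0).

Let dg t : is_derive t 1 g ('D_1 g t).
Proof. by apply/derivableP; have [/(_ t)[]] := geo. Qed.

(** The velocity is itself parallel, so its square norm is constant and the geodesic equation
    becomes linear. *)
Let dg1 t : is_derive t 1 ('D_1 g) (k ^+ 2 *: g t).
Proof.
have [_ pg] := geo.
rewrite -speed -(parallel_along_lorentz_cst geo pg pg t).
exact: parallel_along_is_derive.
Qed.

Lemma geodesicE t : g t = cosh (k * t) *: g 0 + (sinh (k * t) / k) *: 'D_1 g 0.
Proof.
apply/rowP => i; rewrite !mxE.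
apply: (@ode_cosh_sinh _ k (fun s => g s 0 i) (fun s => 'D_1 g s 0 i)).
- by move=> /k0 ->; rewrite mxE.
- by move=> s; have /is_derive_rowP := dg s.
- by move=> s; have /is_derive_rowP/(_ i) := dg1 s; rewrite mxE.
Qed.

(* [V - (<g', V> / k^2) g'] has derivative [0]. *)
Lemma parallel_alongE V t : parallel_along g V ->
  V t = V 0 + (lorentz ('D_1 g 0) (V 0) / k ^+ 2) *: ('D_1 g t - 'D_1 g 0).
Proof.
move=> pV; have [_ pg] := geo.
set a := lorentz ('D_1 g 0) (V 0).
have dV (s : R) : is_derive s 1 V (a *: g s).
  rewrite /a -(parallel_along_lorentz_cst geo pg pV s).
  exact: parallel_along_is_derive.
(* At [k = 0] the velocity vanishes, so [a = 0] and the division by zero is harmless. *)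
have ak : a / k ^+ 2 * k ^+ 2 = a.
  have [k00|kn0] := eqVneq k 0; last by rewrite divfK// sqrf_eq0.
  by rewrite /a (k0 k00) lorentzC lorentz0r !mul0r.
pose W s := V s - (a / k ^+ 2) *: 'D_1 g s.
have W0 : W t = W 0.
  apply: is_derive_row_cst => s.
  apply: (is_derive_eq (is_deriveB (dV s) (is_deriveZ (a / k ^+ 2) (dg1 s)))).
  by rewrite scalerA ak subrr.
have -> : V t = W t + (a / k ^+ 2) *: 'D_1 g t by rewrite /W subrK.
by rewrite W0 /W scalerBr addrAC addrA.
Qed.

End solution.

End geodesics.

(** * Closed forms of the exponential map and of parallel transport *)

Section exponential.
Context {R : realType} {d : nat}.
Implicit Types (x y u v w : 'rV[R]_d.+1) (k t : R).

Definition geodesic_curve x v k t :=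
  cosh (k * t) *: x + (sinh (k * t) / k) *: v.

Section curve.
Variables (x v : 'rV[R]_d.+1) (k : R).
Hypotheses (hx : hyperboloid x) (xv : tangent x v).
Hypotheses (vv : lorentz v v = k ^+ 2) (k0 : k = 0 -> v = 0).

Let xx : lorentz x x = -1. Proof. by have [] := hx. Qed.

Let sinhK t : sinh (k * t) / k * k = sinh (k * t).
Proof.
have [->|kn0] := eqVneq k 0; first by rewrite mul0r sinh0 mul0r mul0r.
by rewrite divfK.
Qed.

Let velocity t := (k * sinh (k * t)) *: x + cosh (k * t) *: v.

Let is_derive_curve t : is_derive t 1 (geodesic_curve x v k) (velocity t).
Proof.
have h1 := is_derive_scale_cst x (is_derive_cosh k t).
have h2 := is_derive_scale_cst v (is_deriveZ k^-1 (is_derive_sinh k t)).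
rewrite (_ : geodesic_curve x v k = (fun s => cosh (k * s) *: x) +
    (fun s => (k^-1 *: (fun r => sinh (k * r))) s *: v)); last first.
  by apply/funext => s; rewrite /geodesic_curve [_ / k]mulrC.
apply: (is_derive_eq (is_deriveD h1 h2)); rewrite /velocity; congr (_ + _).
have [kz|kn0] := eqVneq k 0; first by rewrite (k0 kz) !scaler0.
suff -> : k^-1 *: (k * cosh (k * t)) = cosh (k * t) by [].
exact: mulKf.
Qed.

Let curveD : 'D_1 (geodesic_curve x v k) = velocity.
Proof. by apply/funext => t; have := is_derive_curve t => /@derive_val. Qed.

Let is_derive_velocity t :
  is_derive t 1 velocity (k ^+ 2 *: geodesic_curve x v k t).
Proof.
have h1 := is_derive_scale_cst x (is_deriveZ k (is_derive_sinh k t)).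
have h2 := is_derive_scale_cst v (is_derive_cosh k t).
apply: (is_derive_eq (is_deriveD h1 h2)).
rewrite /geodesic_curve scalerDr; congr (_ + _); rewrite [RHS]scalerA.
  by rewrite expr2 -mulrA.
have -> : k ^+ 2 * (sinh (k * t) / k) = k * (sinh (k * t) / k * k) by ring.
by rewrite sinhK.
Qed.

Let curve_lorentz t :
  lorentz (geodesic_curve x v k t) (geodesic_curve x v k t) = -1.
Proof.
have v' := xv; rewrite /tangent/= in v'.
rewrite /geodesic_curve !lorentzE xx (lorentzC v) v' vv.
rewrite [RHS](_ : _ = - (cosh (k * t) ^+ 2 - (sinh (k * t) / k * k) ^+ 2)).
  by ring.
by rewrite sinhK cosh2_sinh2.
Qed.

Lemma geodesic_curve_hyperboloid t : hyperboloid (geodesic_curve x v k t).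
Proof.
apply: (hyperboloid_lorentz_lt0 hx) => //.
rewrite /geodesic_curve !lorentzE xx xv mulr0 addr0 mulrN1 oppr_lt0.
exact: cosh_gt0.
Qed.

Lemma geodesic_curve0 : geodesic_curve x v k 0 = x.
Proof. by rewrite /geodesic_curve mulr0 cosh0 sinh0 mul0r scale0r addr0 scale1r. Qed.

Lemma geodesic_curve_derive t : 'D_1 (geodesic_curve x v k) t =
  (k * sinh (k * t)) *: x + cosh (k * t) *: v.
Proof. exact: derive_val. Qed.

Lemma geodesic_curve_derive0 : 'D_1 (geodesic_curve x v k) 0 = v.
Proof.
by rewrite geodesic_curve_derive mulr0 cosh0 sinh0 mulr0 scale0r add0r scale1r.
Qed.

Lemma geodesic_curve_is_derive2 t :
  is_derive t 1 ('D_1 (geodesic_curve x v k)) (k ^+ 2 *: geodesic_curve x v k t).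
Proof. rewrite curveD; exact: is_derive_velocity. Qed.

Lemma geodesic_curve_geodesic : geodesic (geodesic_curve x v k).
Proof.
split=> t.
  by split; [exact: geodesic_curve_hyperboloid|have [] := is_derive_curve t].
split.
- rewrite geodesic_curve_derive /tangent/= /geodesic_curve !lorentzE xx vv.
  rewrite (lorentzC v) (xv : lorentz x v = 0) -{1}sinhK; ring.
- by have [] := geodesic_curve_is_derive2 t.
- have [_ ->] := geodesic_curve_is_derive2 t.
  by rewrite /tangent_proj lorentzZr curve_lorentz mulrN1 scaleNr subrr.
Qed.

(** The explicit curve shows that the set under [get] is inhabited; [geodesicE] then computes
    whichever geodesic [get] has picked. *)
Lemma ExpE : Exp x v = cosh k *: x + (sinh k / k) *: v.
Proof.
rewrite /Exp; set P := (X in get X).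
have : P (get P).
  apply: getPex; exists (geodesic_curve x v k 1); exists (geodesic_curve x v k).
  split=> //; [exact: geodesic_curve_geodesic|exact: geodesic_curve0|].
  exact: geodesic_curve_derive0.
move=> [g [geo g0 g1 <-]].
by rewrite (geodesicE geo (k := k)) ?g1 ?g0 ?mulr1.
Qed.

End curve.

(** Parallel transport written without the connecting geodesic: the denominator is at least 2 on the
    hyperboloid, so the case [x = y] is not singular. *)
Definition transport x y v := v + (lorentz y v / (1 - lorentz x y)) *: (x + y).

Lemma geodesic_between x y : hyperboloid x -> hyperboloid y ->
  exists v k, [/\ tangent x v, lorentz v v = k ^+ 2, (k = 0 -> v = 0) &
                  geodesic_curve x v k 1 = y].
Proof.
move=> hx hy; have [xx _] := hx; have [yy _] := hy.
have xy1 : 1 <= - lorentz x y by rewrite lerNr lorentz_le_N1.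
have [k k0 kE] := cosh_surj xy1.
have [kz|kn0] := eqVneq k 0.
  have xyE : x = y.
    by apply: lorentz_eq_N1 => //; rewrite -[LHS]opprK -kE kz cosh0.
  exists 0, 0; split=> //; rewrite /tangent/= ?lorentz0r ?expr0n//.
  by rewrite /geodesic_curve mul0r cosh0 scale1r scaler0 addr0.
have sk : sinh k != 0.
  by rewrite gt_eqF// sinh_gt0// lt_neqAle eq_sym kn0.
have xyE : lorentz x y = - cosh k by rewrite kE opprK.
(* Here [k] is the distance, and the initial velocity is the tangential part [y + <x, y> x] of [y],
   rescaled from length [sinh k] to length [k]. *)
exists ((k / sinh k) *: (y - cosh k *: x)), k; split=> //.
- by rewrite /tangent/= !lorentzE xx xyE; ring.
- rewrite !lorentzE xx yy (lorentzC y) xyE.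
  transitivity (k ^+ 2 * (cosh k ^+ 2 - 1) / sinh k ^+ 2); first by field.
  by rewrite -sinh2E mulfK// sqrf_eq0.
- by move=> kz; move: kn0; rewrite kz eqxx.
- rewrite /geodesic_curve mulr1 scalerA mulrA divfK// divff// scale1r.
  by rewrite addrC subrK.
Qed.

Lemma PTE x y v : hyperboloid x -> hyperboloid y -> tangent x v ->
  PT x y v = transport x y v.
Proof.
move=> hx hy xv; have [xx _] := hx.
rewrite /PT; set P := (X in get X).
have : P (get P).
  apply: getPex.
  have [u [k [xu uu k0 xuy]]] := geodesic_between hx hy.
  have geo := geodesic_curve_geodesic hx xu uu k0.
  pose a := lorentz u v.
  have ak : a / k ^+ 2 * k ^+ 2 = a.
    have [k00|kn0] := eqVneq k 0; last by rewrite divfK// sqrf_eq0.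
    by rewrite /a (k0 k00) lorentzC lorentz0r !mul0r.
  (* The field dictated by [parallel_alongE]. *)
  pose V t := v + (a / k ^+ 2) *: ('D_1 (geodesic_curve x u k) t - u).
  exists (V 1), (geodesic_curve x u k), V; split; split=> //.
  - exact: geodesic_curve0.
  - move=> t.
    have dV : is_derive t 1 V (a *: geodesic_curve x u k t).
      have h := geodesic_curve_is_derive2 x k0 t.
      rewrite (_ : V = cst v + (a / k ^+ 2) *:
        ('D_1 (geodesic_curve x u k) - cst u)); last by [].
      apply: (is_derive_eq (is_deriveD (is_derive_cst v t 1)
        (is_deriveZ (a / k ^+ 2) (is_deriveB h (is_derive_cst u t 1))))).
      by rewrite add0r subr0 scalerA ak.
    have [gH /(_ t)[tg _ _]] := geo; rewrite /tangent/= in tg.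
    have [[gg _] _] := gH t.
    split; [|by have [] := dV|].
      have gv : lorentz (geodesic_curve x u k t) v = sinh (k * t) / k * a.
        by rewrite /geodesic_curve !lorentzE (xv : lorentz x v = 0) mulr0 add0r.
      have gu : lorentz (geodesic_curve x u k t) u = sinh (k * t) / k * k ^+ 2.
        rewrite /geodesic_curve !lorentzE (xu : lorentz x u = 0) mulr0 add0r.
        by rewrite uu.
      rewrite /tangent/= /V lorentzDr lorentzZr lorentzBr tg gv gu sub0r mulrN.
      have -> : a / k ^+ 2 * (sinh (k * t) / k * k ^+ 2) =
        sinh (k * t) / k * (a / k ^+ 2 * k ^+ 2) by ring.
      by rewrite ak subrr.
    have [_ ->] := dV.
    by rewrite /tangent_proj lorentzZr gg mulrN1 scaleNr subrr.
  - by rewrite /V geodesic_curve_derive0// subrr scaler0 addr0.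
move=> [g [V [[geo g0 g1] [pV V0 <-]]]].
have tg0 : tangent x ('D_1 g 0) by rewrite -g0; have [_ /(_ 0)[]] := geo.
have [k speed k0] := tangent_speed hx tg0.
set u := 'D_1 g 0 in tg0 speed k0 *.
have gE : g = geodesic_curve x u k.
  by apply/funext => t; rewrite (geodesicE geo speed k0) g0.
rewrite (parallel_alongE geo speed k0 1 pV) V0 -/u gE.
rewrite geodesic_curve_derive// mulr1 /transport -g1 gE /geodesic_curve mulr1.
rewrite !lorentzE xx (tg0 : lorentz x u = 0) (xv : lorentz x v = 0).
congr (_ + _).
have [kz|kn0] := eqVneq k 0.
  by rewrite (k0 kz) lorentzC lorentz0r mul0r !mulr0 addr0 mul0r !scale0r.
have c0 := cosh_gt0 k.
have c1 : 1 + cosh k != 0 by lra.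
apply/rowP => i; rewrite !mxE; move: (x 0 i) (u 0 i) (lorentz u v) => X U a.
have -> : 1 - (cosh k * -1 + sinh k / k * 0) = 1 + cosh k by ring.
rewrite mulr0 add0r.
(* Writing [cosh k - 1] as [sinh k ^ 2 / (1 + cosh k)] brings out the denominator
   [1 - <x, y> = 1 + cosh k] of [transport]. *)
have -> : k * sinh k * X + cosh k * U - U =
    k * sinh k * X + (cosh k ^+ 2 - 1) / (1 + cosh k) * U by field.
rewrite -sinh2E.
by field; rewrite kn0 c1.
Qed.

End exponential.

(** * The wrapping map *)

Section wrapping.
Context {R : realType} {d : nat}.
Implicit Types (x y mu nu v w : 'rV[R]_d.+1) (z : 'rV[R]_d) (c : R).

Lemma transportZ x y c v :
  transport x y (c *: v) = c *: transport x y v.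
Proof. by rewrite /transport lorentzZr -mulrA -scalerA -scalerDr. Qed.

Lemma transportN x y v : transport x y (- v) = - transport x y v.
Proof. by rewrite -scaleN1r transportZ scaleN1r. Qed.

Section isometry.
Variables x y : 'rV[R]_d.+1.
Hypotheses (hx : hyperboloid x) (hy : hyperboloid y).

Let xx : lorentz x x = -1. Proof. by have [] := hx. Qed.
Let yy : lorentz y y = -1. Proof. by have [] := hy. Qed.
Let xy : 1 - lorentz x y != 0.
Proof. by have := lorentz_le_N1 hx hy; lra. Qed.

Lemma transport_tangent v : tangent y (transport x y v).
Proof.
rewrite /tangent/= /transport !lorentzE yy (lorentzC y x); field; exact: xy.
Qed.

Lemma transport_isometry v : tangent x v ->
  lorentz (transport x y v) (transport x y v) = lorentz v v.
Proof.
rewrite /tangent/= => xv; rewrite /transport !lorentzE xx yy (lorentzC v x).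
by rewrite (lorentzC v y) (lorentzC y x) xv; field; exact: xy.
Qed.

Lemma transportK v : tangent x v -> transport y x (transport x y v) = v.
Proof.
rewrite /tangent/= => xv; rewrite {1}/transport.
have -> : lorentz x (transport x y v) = - lorentz y v.
  by rewrite /transport !lorentzE xx xv; field; exact: xy.
rewrite (lorentzC y x) mulNr scaleNr (addrC y x).
by rewrite /transport addrK.
Qed.

End isometry.

Definition norm2 z : R := (z *m z^T) 0 0.

Lemma norm2E z : norm2 z = \sum_j z 0 j ^+ 2.
Proof. by rewrite /norm2 mxE; apply: eq_bigr => j _; rewrite mxE expr2. Qed.

Lemma norm2_ge0 z : 0 <= norm2 z.
Proof. by rewrite norm2E sumr_ge0// => j _; exact: sqr_ge0. Qed.

Lemma norm2N z : norm2 (- z) = norm2 z.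
Proof. by rewrite !norm2E; apply: eq_bigr => j _; rewrite mxE sqrrN. Qed.

Lemma norm2_eq0 z : norm2 z = 0 -> z = 0.
Proof.
move/eqP; rewrite norm2E psumr_eq0; last by move=> j _; exact: sqr_ge0.
move=> /allP z0; apply/rowP => j; rewrite mxE.
by have := z0 j (mem_index_enum _); rewrite sqrf_eq0 => /eqP.
Qed.

Definition norm z : R := Num.sqrt (norm2 z).

Lemma norm_ge0 z : 0 <= norm z. Proof. exact: sqrtr_ge0. Qed.

Lemma sqr_norm z : norm z ^+ 2 = norm2 z.
Proof. by rewrite sqr_sqrtr// norm2_ge0. Qed.

Lemma norm_eq0 z : norm z = 0 -> z = 0.
Proof. by move=> z0; apply: norm2_eq0; rewrite -sqr_norm z0 expr0n. Qed.

Definition embed z : 'rV[R]_d.+1 := row_mx (0 : 'rV_1) z.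

Lemma embed0 z : embed z 0 ord0 = 0.
Proof. by rewrite mxE; case: splitP => [i _|//]; rewrite mxE. Qed.

Lemma embed_lift z j : embed z 0 (lift ord0 j) = z 0 j.
Proof.
rewrite mxE; case: splitP => [i|k] /=; first by rewrite ord1.
by rewrite /bump/= => -[/ord_inj ->].
Qed.

Lemma embedN z : embed (- z) = - embed z.
Proof.
apply: row_lift_eq => [|j].
  by rewrite [RHS]mxE !embed0 oppr0.
by rewrite [RHS]mxE !embed_lift mxE.
Qed.

Lemma embed_tangent z : tangent origin (embed z).
Proof. by rewrite /tangent/= lorentz_originl embed0 oppr0. Qed.

Lemma lorentz_embed z : lorentz (embed z) (embed z) = norm2 z.
Proof.
rewrite /lorentz embed0 mul0r oppr0 add0r norm2E.
by apply: eq_bigr => j _; rewrite embed_lift expr2.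
Qed.

Lemma lorentz_embedr x z :
  lorentz x (embed z) = \sum_j x 0 (lift ord0 j) * z 0 j.
Proof.
rewrite /lorentz embed0 mulr0 oppr0 add0r.
by apply: eq_bigr => j _; rewrite embed_lift.
Qed.

Definition wrap mu z : 'rV[R]_d.+1 := cosh (norm z) *: mu +
  (sinh (norm z) / norm z) *: transport origin mu (embed z).

(** The linear map fixing [mu] and acting as -1 on the tangent space at [mu]. *)
Definition reflect mu x := - x - (2 * lorentz mu x) *: mu.

(** Self-adjointness lets the reflection of a random point be traded for that of the fixed vector it
    is paired with. *)
Lemma lorentz_reflect mu x y :
  lorentz (reflect mu x) y = lorentz x (reflect mu y).
Proof. by rewrite /reflect !lorentzE (lorentzC x mu); ring. Qed.

Section wrap_at.
Variable mu : 'rV[R]_d.+1.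
Hypothesis hmu : hyperboloid mu.

Let B_tangent z : tangent mu (transport origin mu (embed z)).
Proof. exact: transport_tangent origin_hyperboloid hmu _. Qed.

Let B_norm z : lorentz (transport origin mu (embed z))
  (transport origin mu (embed z)) = norm z ^+ 2.
Proof.
rewrite (transport_isometry origin_hyperboloid hmu (embed_tangent z)).
by rewrite lorentz_embed sqr_norm.
Qed.

Let B0 z : norm z = 0 -> transport origin mu (embed z) = 0.
Proof.
move=> /norm_eq0 ->; rewrite (_ : embed 0 = 0 *: 0) ?transportZ ?scale0r//.
by apply: row_lift_eq => [|j]; rewrite ?embed0 ?embed_lift !mxE ?mulr0.
Qed.

Lemma Exp_PT z : Exp mu (PT origin mu (embed z)) = wrap mu z.
Proof.
rewrite (PTE origin_hyperboloid hmu (embed_tangent z)).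
by rewrite (ExpE hmu (B_tangent z) (B_norm z) (@B0 z)).
Qed.

Lemma wrap_hyperboloid z : hyperboloid (wrap mu z).
Proof.
have := geodesic_curve_hyperboloid hmu (B_tangent z) (B_norm z) 1.
by rewrite /geodesic_curve mulr1.
Qed.

Lemma lorentz_wrap z : lorentz mu (wrap mu z) = - cosh (norm z).
Proof.
have [mm _] := hmu; have mB := B_tangent z; rewrite /tangent/= in mB.
by rewrite /wrap lorentzDr !lorentzZr mm mB; ring.
Qed.

Lemma wrapN z : wrap mu (- z) = reflect mu (wrap mu z).
Proof.
rewrite /reflect lorentz_wrap /wrap /norm norm2N -/(norm z) embedN transportN.
by apply/rowP => i; rewrite !mxE; ring.
Qed.

(** The tangential part of [x] at [mu], transported back to the origin. It inverts [wrap] only up to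
    a nonnegative factor, which is enough for the sign of a quadratic form, and being linear in [x]
    it is plainly Borel. *)
Definition unwrap x : 'rV[R]_d :=
  \row_j transport mu origin (x + lorentz mu x *: mu) 0 (lift ord0 j).

Lemma unwrap_wrap z : unwrap (wrap mu z) = (sinh (norm z) / norm z) *: z.
Proof.
apply/rowP => j; rewrite [LHS]mxE [RHS]mxE lorentz_wrap /wrap.
rewrite (_ : _ + _ + _ = (sinh (norm z) / norm z) *: transport origin mu (embed z)).
  rewrite transportZ (transportK origin_hyperboloid hmu (embed_tangent z)).
  by rewrite [LHS]mxE embed_lift.
by rewrite scaleNr addrAC subrr add0r.
Qed.

End wrap_at.

Lemma HWNE mu (Sigma : 'M[R]_d) (B : set (@ambient R d)) : hyperboloid mu ->
  HWN mu Sigma B =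
  normal_tuple Sigma [set z | B (wrap mu (row_of_tuple z))].
Proof.
move=> hmu; rewrite /HWN /pushforward; congr normal_tuple.
by apply/seteqP; split=> z /=; rewrite -Exp_PT.
Qed.

(* Two point reflections whose centres differ compose to a translation along the
   geodesic through them; the vectors below span null directions it rescales. *)
Lemma reflect_null mu mu' : hyperboloid mu -> hyperboloid mu' -> mu != mu' ->
  exists (n : 'rV[R]_d.+1) (c : R), [/\ 0 < c < 1, lorentz n n = 0, n != 0 &
    reflect mu' (reflect mu n) = c *: n].
Proof.
move=> hmu hmu' neq; have [mm _] := hmu; have [mm' _] := hmu'.
pose C := - lorentz mu mu'.
have C1 : 1 < C.
  rewrite lt_neqAle lerNr lorentz_le_N1// andbT eq_sym.
  apply: contra_neq neq => C1; apply: lorentz_eq_N1 => //.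
  by rewrite -[LHS]opprK -/C C1.
pose s := Num.sqrt (C ^+ 2 - 1).
have s2 : s ^+ 2 = C ^+ 2 - 1 by rewrite sqr_sqrtr// subr_ge0 expr_ge1//; lra.
have s0 : 0 <= s by exact: sqrtr_ge0.
(* Since [C] is the [cosh] of the distance [D] between the centres, [a = e^D]. The vector
   [b mu - mu'] is null exactly for [b = a] and [b = a^-1]; the first choice gives the factor
   [e^(-2D)], below 1. *)
pose a := C + s.
have a1 : 1 < a by rewrite /a; lra.
have a0 : a != 0 by lra.
have aE : lorentz mu mu' = - (a + a^-1) / 2.
  rewrite -[LHS]opprK -/C; apply: (mulfI a0).
  rewrite [RHS](_ : _ = - (a ^+ 2 + 1) / 2); last by field.
  by rewrite /a sqrrD s2; field.
exists (a *: mu - mu'), (a ^- 2); split.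
- by rewrite invr_gt0 exprn_gt0 ?invf_lt1 ?exprn_egt1 ?exprn_gt0//; lra.
- by rewrite !lorentzE mm mm' (lorentzC mu' mu) aE; field.
- apply: contraTneq a1 => /eqP; rewrite subr_eq0 => /eqP e.
  have : a ^+ 2 * -1 = -1 by rewrite -{2}mm' -e !lorentzE mm; ring.
  rewrite mulrN1 => /oppr_inj/eqP; rewrite sqrf_eq1 => /orP[]/eqP ->;
    rewrite ?ltxx//.
  by rewrite -leNgt; lra.
- rewrite /reflect !lorentzE mm mm' (lorentzC mu' mu) aE.
  by apply/rowP => i; rewrite !mxE; field.
Qed.

End wrapping.

(** * Lebesgue measure on tuples *)

Section lebesgue_tuple.
Local Open Scope ereal_scope.
Context {R : realType}.
Local Notation RT := (measurableTypeR R).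

Definition tuple_opp n (t : n.-tuple RT) : n.-tuple RT :=
  [tuple of map -%R t].

Lemma measurable_tuple_opp n : measurable_fun setT (@tuple_opp n).
Proof.
apply/measurable_fun_tnthP => i.
rewrite (_ : _ \o _ = (-%R : RT -> RT) \o (@tnth n RT ^~ i)); last first.
  by apply/funext => t /=; rewrite tnth_map.
by apply: measurableT_comp => //; exact: measurable_tnth.
Qed.

(** By induction: on pairs the sign change acts factorwise, so the transported measure agrees with
    the product measure on rectangles, which determine it. *)
Lemma lebesgue_tuple_opp n (A : set (n.-tuple RT)) : measurable A ->
  lebesgue_tuple n (@tuple_opp n @^-1` A) = lebesgue_tuple n A.
Proof.
elim: n A => [|n IH] A mA.
  rewrite /= (_ : tuple_opp (n:=0) @^-1` A = A)//.
  by apply/seteqP; split=> t /=; rewrite !(tuple0 t) (tuple0 (tuple_opp _)).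
rewrite /= /cons_measure /pushforward.
pose N (p : RT * n.-tuple RT) := ((- p.1)%R : RT, tuple_opp p.2).
have mN : measurable_fun setT N.
  apply/measurable_fun_pairP; split.
    rewrite (_ : _ \o _ = (-%R : RT -> RT) \o fst)//.
    exact: measurableT_comp.
  rewrite (_ : _ \o _ = @tuple_opp n \o snd)//.
  apply: measurableT_comp => //. exact: measurable_tuple_opp.
rewrite -comp_preimage.
rewrite (_ : @tuple_opp n.+1 \o _ =
    (fun p : RT * n.-tuple RT => [tuple of p.1 :: p.2]) \o N); last first.
  by apply/funext => -[x t]; apply: val_inj.
rewrite comp_preimage.
have mB : measurable
    ((fun p : RT * n.-tuple RT => [tuple of p.1 :: p.2]) @^-1` A).
  by rewrite -[X in measurable X]setTI; exact: measurable_cons.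
apply/esym; rewrite -[RHS]/(pushforward _ N _).
pose m' := measure_function_pushforward__canonical__measure_function_Measure
  (lebesgue_measure \x lebesgue_tuple n) mN.
apply: (product_measure_unique (m' := m')) => //= B C mB' mC.
rewrite /pushforward.
rewrite (_ : N @^-1` _ = ((-%R : RT -> RT) @^-1` B) `*` (@tuple_opp n @^-1` C)).
  rewrite product_measure1E ?IH//.
  - by congr (_ * _); exact: lebesgue_measureN.
  - by rewrite -[X in measurable X]setTI; exact: oppr_measurable.
  - by rewrite -[X in measurable X]setTI; exact: measurable_tuple_opp.
by apply/seteqP; split.
Qed.

Lemma ge0_integral_tuple_opp n (A : set (n.-tuple RT)) (f : n.-tuple RT -> R) :
  measurable A -> measurable_fun setT f -> (forall t, 0 <= f t)%R ->
  (forall t, f (tuple_opp t) = f t) ->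
  \int[lebesgue_tuple n]_(t in @tuple_opp n @^-1` A) (f t)%:E =
  \int[lebesgue_tuple n]_(t in A) (f t)%:E.
Proof.
move=> mA mf f0 fN.
transitivity (\int[pushforward (lebesgue_tuple n) (@tuple_opp n)]_(t in A)
    (f t)%:E).
  rewrite (ge0_integral_pushforward (measurable_tuple_opp (n := n)))//.
  - by apply: eq_integral => t _ /=; rewrite fN.
  - exact/measurable_EFinP/measurable_funTS.
  - by move=> t _; rewrite lee_fin.
pose m' := measure_function_pushforward__canonical__measure_function_Measure
  (lebesgue_tuple n) (measurable_tuple_opp (n := n)).
apply: (@eq_measure_integral _ _ _ _ (lebesgue_tuple n) m').
by move=> B mB _; exact: lebesgue_tuple_opp.
Qed.

Lemma ge0_integral_lebesgue_tupleS n (f : n.+1.-tuple RT -> \bar R) :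
  measurable_fun setT f -> (forall t, 0 <= f t) ->
  \int[lebesgue_tuple n.+1]_t f t =
  \int[lebesgue_measure]_x \int[lebesgue_tuple n]_t f [tuple of x :: t].
Proof.
move=> mf f0.
have mc : measurable_fun setT
    (fun p : RT * n.-tuple RT => [tuple of p.1 :: p.2]).
  exact: measurable_cons.
transitivity (\int[lebesgue_measure \x lebesgue_tuple n]_p
    f [tuple of p.1 :: p.2]).
  rewrite [LHS](ge0_integral_pushforward mc
    (lebesgue_measure \x lebesgue_tuple n)) => //.
by rewrite fubini_tonelli1//; exact: measurableT_comp.
Qed.

Lemma measurable_prod_tnth n (g : R -> R) : measurable_fun setT g ->
  measurable_fun setT (fun t : n.-tuple RT => (\prod_(i < n) g (tnth t i))%R).
Proof.
move=> mg; apply: measurable_prod => i _.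
by apply: measurableT_comp => //; exact: measurable_tnth.
Qed.

(** Tonelli splits off one coordinate at a time. With [g] a one-dimensional Gaussian this bounds the
    mass of [normal_tuple]. *)
Lemma integral_prod_tnth_lty n (g : R -> R) : measurable_fun setT g ->
  (forall x, 0 <= g x)%R -> \int[lebesgue_measure]_x (g x)%:E < +oo ->
  \int[lebesgue_tuple n]_t (\prod_(i < n) g (tnth t i))%:E < +oo.
Proof.
move=> mg g0 gi; elim: n => [|n IH].
  rewrite /= (eq_integral (cst 1)); last by move=> t _; rewrite big_ord0.
  rewrite integral_cst//= mul1e.  by rewrite /dirac indicT ltry.
have p0 m (t : m.-tuple RT) : (0 <= \prod_(i < m) g (tnth t i))%R.
  by apply: prodr_ge0 => i _; exact: g0.
rewrite ge0_integral_lebesgue_tupleS; first last.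
- by move=> t; rewrite lee_fin.
- apply/measurable_EFinP; exact: (measurable_prod_tnth mg).
rewrite (eq_integral (fun x : RT => (g x)%:E *
    \int[lebesgue_tuple n]_t (\prod_(i < n) g (tnth t i))%:E)); last first.
  move=> x _; rewrite -ge0_integralZl_EFin//.
  - apply: eq_integral => t _; rewrite big_ord_recl (_ : tnth _ ord0 = x)//.
    by under eq_bigr do rewrite tnthS.
  - by move=> t _; rewrite lee_fin.
  - by apply/measurable_EFinP; exact: (measurable_prod_tnth mg).
rewrite ge0_integralZr//.
- have gI : 0 <= \int[lebesgue_measure]_(x in [set: RT]) (g x)%:E.
    by apply: integral_ge0 => x _; rewrite lee_fin.
  by apply: lte_mul_pinfty => //; rewrite ge0_fin_numE.
- exact/measurable_EFinP.
- by move=> x _; rewrite lee_fin.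
- by apply: integral_ge0 => t _; rewrite lee_fin.
Qed.

Definition box n (a : 'I_n -> R) (e : R) : set (n.-tuple RT) :=
  [set t | forall i, (`|tnth t i - a i| < e)%R].

Lemma measurable_box n (a : 'I_n -> R) (e : R) : measurable (box a e).
Proof.
rewrite (_ : box a e = \bigcap_(i in setT)
    (@tnth n RT ^~ i) @^-1` `](a i - e)%R, (a i + e)%R[); last first.
  apply/seteqP; split => t /= h i; first by move=> _; rewrite /= in_itv/= -ltr_distl.
  by have := h i I; rewrite /= in_itv/= -ltr_distl.
apply: fin_bigcap_measurable => // i _; rewrite -[X in measurable X]setTI.
exact: measurable_tnth.
Qed.

Lemma box_gt0 n (a : 'I_n -> R) (e : R) : (0 < e)%R ->
  0 < lebesgue_tuple n (box a e).
Proof.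
move=> e0; elim: n a => [|n IH] a.
  by rewrite /= diracE mem_set ?lte01// => -[].
rewrite /= /cons_measure /pushforward.
rewrite (_ : _ @^-1` _ =
  `](a ord0 - e)%R, (a ord0 + e)%R[ `*` box (a \o lift ord0) e).
  rewrite product_measure1E//; last exact: measurable_box.
  apply: mule_gt0; last exact: IH.
  suff : 0 < lebesgue_measure
      (`](a ord0 - e)%R, (a ord0 + e)%R[%classic : set R) by [].
  rewrite lebesgue_measure_itv/= lte_fin ifT; last by lra.
  by rewrite -EFinB lte_fin; lra.
apply/seteqP; split => [[x t] /= xt|[x t] [/= xa ta] i].
  split=> [|i] /=.
    by have := xt ord0; rewrite in_itv/= ltr_distl.
  by have := xt (lift ord0 i); rewrite tnthS.
case: (unliftP ord0 i) => [j|] ->; first by rewrite tnthS; exact: ta.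
by move: xa; rewrite in_itv/= ltr_distl.
Qed.

(** The topology lives on row vectors and the measure on tuples; sup-norm balls, which are boxes,
    link the two. *)
Lemma nbhs_row_of_tuple_gt0 n (a : 'rV[R]_n) (P : set 'rV[R]_n)
    (D : set (n.-tuple RT)) : nbhs a P -> measurable D ->
  (forall t, P (row_of_tuple t) -> D t) -> 0 < lebesgue_tuple n D.
Proof.
move=> /nbhs_ballP[e /= e0 eP] mD PD.
apply: (lt_le_trans (box_gt0 (a 0%R) e0)).
apply: le_measure; rewrite ?inE//; first exact: measurable_box.
move=> t ht; apply: PD; apply: eP; split=> // i j.
by rewrite mxE -ball_normE/= ord1 distrC; exact: ht.
Qed.

Lemma integral_gt0_neq0 n (D : set (n.-tuple RT)) (f : n.-tuple RT -> R) :
  measurable D -> 0 < lebesgue_tuple n D -> measurable_fun D f ->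
  (forall t, D t -> 0 < f t)%R ->
  \int[lebesgue_tuple n]_(t in D) (f t)%:E != 0.
Proof.
move=> mD D0 mf f0; apply/eqP => f_eq0.
have : \int[lebesgue_tuple n]_(t in D) `|(f t)%:E| = 0.
  rewrite -[RHS]f_eq0; apply: eq_integral => t /set_mem Dt.
  by rewrite gee0_abs// lee_fin ltW// f0.
have mfE : measurable_fun D (EFin \o f) by exact/measurable_EFinP.
move/(ae_eq_integral_abs _ mD mfE) => [N [mN N0 DN]].
have : lebesgue_tuple n D <= 0.
  rewrite -N0; apply: le_measure; rewrite ?inE// => t Dt; apply: DN => /=.
  move=> /(_ Dt) [] ft0; have := f0 _ Dt; by rewrite ft0 ltxx.
by rewrite leNgt D0.
Qed.

End lebesgue_tuple.

(** * Positive definite forms *)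

Section quadratic_forms.
Context {R : realType} {d : nat}.
Implicit Types (A S : 'M[R]_d) (y z : 'rV[R]_d) (c : R).

Definition qform A z : R := (z *m A *m z^T) 0 0.

Lemma qformE A z : qform A z = \sum_j (\sum_i z 0 i * A i j) * z 0 j.
Proof. by rewrite /qform mxE; apply: eq_bigr => j _; rewrite !mxE. Qed.

Lemma qformZ A c z : qform A (c *: z) = c ^+ 2 * qform A z.
Proof. by rewrite /qform linearZ/= -!scalemxAl -scalemxAr !mxE mulrA. Qed.

Lemma qformN A z : qform A (- z) = qform A z.
Proof. by rewrite -[- z]scaleN1r qformZ sqrrN expr1n mul1r. Qed.

Lemma qform0 A : qform A 0 = 0.
Proof. by rewrite /qform mul0mx mul0mx mxE. Qed.

Lemma qformB A B z : qform (A - B) z = qform A z - qform B z.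
Proof. by rewrite /qform mulmxBr mulmxBl !mxE. Qed.

Lemma qform_le A : exists2 C, 0 < C & forall z, qform A z <= C * norm2 z.
Proof.
(* Each term satisfies [|A_ij z_i z_j| <= |A_ij| norm2 z]; the added 1 makes [C] positive even for
   [A = 0]. *)
pose C := 1 + \sum_j \sum_i `|A i j|.
have s0 : 0 <= \sum_j \sum_i `|A i j|.
  by apply: sumr_ge0 => j _; apply: sumr_ge0 => i _; exact: normr_ge0.
exists C; first by rewrite /C; lra.
move=> z; apply: (@le_trans _ _ ((\sum_j \sum_i `|A i j|) * norm2 z)); last first.
  by rewrite ler_wpM2r ?norm2_ge0// /C; lra.
rewrite qformE mulr_suml; apply: ler_sum => j _.
rewrite !mulr_suml; apply: ler_sum => i _.
have zi k : z 0 k ^+ 2 <= norm2 z.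
  by rewrite norm2E (bigD1 k)//= lerDl sumr_ge0// => l _; exact: sqr_ge0.
rewrite (_ : z 0 i * A i j * z 0 j = A i j * (z 0 i * z 0 j)); last by ring.
apply: (le_trans (ler_norm _)); rewrite normrM ler_wpM2l// normrM.
have := zi i; have := zi j; rewrite -(real_normK (num_real (z 0 i))).
rewrite -(real_normK (num_real (z 0 j))).
by move: (`|z 0 i|) (`|z 0 j|) => a b; have := sqr_ge0 (a - b); lra.
Qed.

Lemma bilinearC A y z : A^T = A ->
  (y *m A *m z^T) 0 0 = (z *m A *m y^T) 0 0.
Proof.
move=> At; rewrite -[in RHS](trmxK (z *m A *m y^T)) [in RHS]mxE.
by rewrite !trmx_mul trmxK At mulmxA.
Qed.

Lemma qform_sub A c y z : A^T = A ->
  qform A (y - c *: z) =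
  qform A y - 2 * c * (y *m A *m z^T) 0 0 + c ^+ 2 * qform A z.
Proof.
move=> At; rewrite -qformZ /qform linearB/= mulmxBl !mulmxBr !mulmxBl.
have e1 : (c *: z *m A *m y^T) 0 0 = c * (y *m A *m z^T) 0 0.
  by rewrite -!scalemxAl mxE (bilinearC _ _ At).
have e2 : (y *m A *m (c *: z)^T) 0 0 = c * (y *m A *m z^T) 0 0.
  by rewrite linearZ/= -scalemxAr mxE.
by rewrite !mxE in e1 e2 *; rewrite e1 e2; ring.
Qed.

Lemma qform_inj A B : A^T = A -> B^T = B -> qform A =1 qform B -> A = B.
Proof.
move=> At Bt AB; apply/matrixP => i j.
have AE (M : 'M[R]_d) k l :
    ((delta_mx 0 k : 'rV_d) *m M *m (delta_mx 0 l)^T) 0 0 = M k l.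
  rewrite -rowE mxE (bigD1 l)//= big1 ?addr0; first by rewrite !mxE !eqxx mulr1.
  by move=> m ml; rewrite !mxE (negbTE ml) andbF mulr0.
(* Polarisation at [e_i + e_j], written as a difference so that [qform_sub] applies. *)
have := AB (delta_mx 0 i - (-1) *: delta_mx 0 j).
rewrite !qform_sub// !AE -!/(qform _ _) !AB; lra.
Qed.

Section spd.
Variable S : 'M[R]_d.
Hypothesis hS : spd S.

Let St : S^T = S. Proof. by have [] := hS. Qed.

Lemma spd_qform_ge0 z : 0 <= qform S z.
Proof.
have [->|z0] := eqVneq z 0; first by rewrite qform0.
by apply: ltW; have [_] := hS; exact.
Qed.

(* The segment from the identity to [S] consists of invertible matrices. *)
Lemma spd_det_gt0 : 0 < \det S.
Proof.
pose M : 'M[{poly R}]_d := (1 - 'X)%:M + 'X *: map_mx polyC S.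
have ME t : (\det M).[t] = \det ((1 - t)%:M + t *: S).
  rewrite -horner_evalE -det_map_mx; congr (\det _).
  apply/matrixP => i j; rewrite !mxE /= !horner_evalE !hornerE.
  by case: eqP => _; rewrite ?mulr1n ?mulr0n !hornerE.
rewrite ltNge; apply/negP => S0.
have [|x /andP[x0 x1]] := @poly_ivt R (- \det M) 0 1 ler01.
  rewrite !hornerN !ME subr0 scale0r addr0 det1 subrr scale1r.
  by rewrite raddf0 add0r oppr_le0 ler01 oppr_ge0 S0.
rewrite rootN /root ME => /det0P[v v0] vM.
have : ((1 - x) * norm2 v + x * qform S v) = 0.
  have := congr1 (fun u : 'rV_d => (u *m v^T) 0 0) vM.
  rewrite mulmxDr mulmxDl mul_mx_scalar -scalemxAr -!scalemxAl mul0mx !mxE.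
  by rewrite /norm2 /qform !mxE.
have n0 : 0 < norm2 v.
  by rewrite lt_neqAle norm2_ge0 eq_sym andbT; apply: contra_neq v0 => /norm2_eq0.
have q0 : 0 < qform S v by have [_] := hS; exact.
by have := mulr_ge0 x0 (ltW q0); nra.
Qed.

Lemma spd_unitmx : S \in unitmx.
Proof. by rewrite unitmxE unitfE gt_eqF// spd_det_gt0. Qed.

Lemma spd_invmx_sym : (invmx S)^T = invmx S.
Proof. by rewrite trmx_inv St. Qed.

(* Expand [0 <= qform S (z S^-1 - z / C)], where [qform S <= C * norm2]. *)
Lemma spd_invmx_ge :
  exists2 C, 0 < C & forall z, norm2 z / C <= qform (invmx S) z.
Proof.
have [C C0 CP] := qform_le S; exists C => // z.
have := spd_qform_ge0 (z *m invmx S - C^-1 *: z).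
rewrite qform_sub//.
have -> : qform S (z *m invmx S) = qform (invmx S) z.
  by rewrite /qform mulmxKV ?spd_unitmx// trmx_mul spd_invmx_sym mulmxA.
rewrite mulmxKV ?spd_unitmx// -/(norm2 z) => h.
have : C^-1 ^+ 2 * qform S z <= norm2 z / C.
  rewrite (_ : norm2 z / C = C^-1 ^+ 2 * (C * norm2 z)).
    by rewrite ler_wpM2l ?sqr_ge0.
  by field; rewrite gt_eqF.
by move: h; rewrite (_ : 2 * C^-1 * norm2 z = 2 * (norm2 z / C)); [lra|ring].
Qed.

End spd.

End quadratic_forms.

(** * Gaussian laws *)

Section gaussian_law.
Local Open Scope ereal_scope.
Context {R : realType} {d : nat}.
Local Notation RT := (measurableTypeR R).
Implicit Types (A S : 'M[R]_d) (t : d.-tuple RT) (D : set (d.-tuple RT)).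

Lemma row_of_tuple_opp t : row_of_tuple (tuple_opp t) = (- row_of_tuple t)%R.
Proof. by apply/rowP => i; rewrite !mxE tnth_map. Qed.

Lemma measurable_row_of_tuple i :
  measurable_fun setT (fun t => row_of_tuple t 0%R i).
Proof.
rewrite (_ : (fun t => _) = @tnth d RT ^~ i); first exact: measurable_tnth.
by apply/funext => t; rewrite mxE.
Qed.

Lemma measurable_qform A : measurable_fun setT (fun t => qform A (row_of_tuple t)).
Proof.
under eq_fun do rewrite qformE.
apply: measurable_sum => j; apply: measurable_funM.
  apply: measurable_sum => i; apply: measurable_funM => //.
  exact: measurable_row_of_tuple.
exact: measurable_row_of_tuple.
Qed.

Definition normal_const S : R := (Num.sqrt ((pi *+ 2) ^+ d * \det S))^-1.

Lemma normal_tuple_pdfE S t : normal_tuple_pdf S t =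
  (normal_const S * expR (- (qform (invmx S) (row_of_tuple t) / 2)))%R.
Proof. by []. Qed.

Lemma normal_const_gt0 S : spd S -> (0 < normal_const S)%R.
Proof.
move=> hS; rewrite invr_gt0 sqrtr_gt0 mulr_gt0 ?spd_det_gt0// exprn_gt0//.
by rewrite pmulrn_lgt0// pi_gt0.
Qed.

Lemma normal_tuple_pdf_ge0 S t : (0 <= normal_tuple_pdf S t)%R.
Proof. by rewrite mulr_ge0 ?expR_ge0// invr_ge0 sqrtr_ge0. Qed.

Lemma normal_tuple_pdf_gt0 S t : spd S -> (0 < normal_tuple_pdf S t)%R.
Proof. by move=> hS; rewrite mulr_gt0 ?expR_gt0// normal_const_gt0. Qed.

Lemma measurable_normal_tuple_pdf S : measurable_fun setT (@normal_tuple_pdf R d S).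
Proof.
rewrite (_ : normal_tuple_pdf S = fun t =>
    (normal_const S * expR (- (qform (invmx S) (row_of_tuple t) / 2)))%R)//.
apply: measurable_funM => //; apply: measurableT_comp => //.
apply: measurable_funN; apply: measurable_funM => //; exact: measurable_qform.
Qed.

Lemma integral_expR_sqr_lty (C : R) : (0 < C)%R ->
  \int[lebesgue_measure]_(x in [set: RT]) (expR (- (x ^+ 2 / C / 2)))%:E < +oo.
Proof.
move=> C0; pose s := Num.sqrt C.
have s0 : (0 < s)%R by rewrite sqrtr_gt0.
have sn0 : s != 0%R by rewrite gt_eqF.
rewrite (eq_integral (fun x : RT => (normal_peak s)^-1%:E * (normal_pdf 0 s x)%:E)).
  rewrite ge0_integralZl_EFin//.
  - by rewrite integral_normal_pdf mule1 ltry.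
  - by move=> x _; rewrite lee_fin normal_pdf_ge0.
  - by apply/measurable_EFinP; exact: measurable_normal_pdf.
  - by rewrite invr_ge0 normal_peak_ge0.
move=> x _; rewrite normal_pdfE// -EFinM mulKf ?gt_eqF ?normal_peak_gt0//.
rewrite /normal_fun subr0 /s sqr_sqrtr ?ltW//; congr (expR _)%:E.
by field; rewrite gt_eqF.
Qed.

(** By [spd_invmx_ge] the density is dominated by a product of one-dimensional Gaussians. Finiteness
    is what later allows masses to be cancelled and integrals to be subtracted. *)
Lemma normal_tuple_lty S D : spd S -> measurable D -> normal_tuple S D < +oo.
Proof.
move=> hS mD; have [C C0 CP] := spd_invmx_ge hS.
pose g x : R := expR (- (x ^+ 2 / C / 2)).
have mg : measurable_fun setT g.
  apply: measurableT_comp => //; apply: measurable_funN.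
  by do 2 apply: measurable_funM => //; exact: measurable_funX.
have g0 x : (0 <= g x)%R by exact: expR_ge0.
have gi := integral_expR_sqr_lty C0.
have := integral_prod_tnth_lty d mg g0 gi.
have mG := measurable_prod_tnth (n := d) mg.
pose G t := (\prod_(i < d) g (tnth t i))%R.
have G0 t : (0 <= G t)%R by apply: prodr_ge0 => i _; exact: g0.
move=> Glty.
apply: (@le_lt_trans _ _ (\int[lebesgue_tuple d]_t (normal_const S * G t)%:E)).
  apply: (@le_trans _ _ (\int[lebesgue_tuple d]_t (normal_tuple_pdf S t)%:E)).
    apply: ge0_subset_integral => //.
    - by apply/measurable_EFinP; exact: measurable_normal_tuple_pdf.
    - by move=> t _; rewrite lee_fin normal_tuple_pdf_ge0.
  apply: ge0_le_integral => //.
  - by move=> t _; rewrite lee_fin normal_tuple_pdf_ge0.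
  - by apply/measurable_EFinP; exact: measurable_normal_tuple_pdf.
  - by apply/measurable_EFinP; apply: measurable_funM.
  move=> t _; rewrite lee_fin normal_tuple_pdfE.
  apply: ler_wpM2l; first exact/ltW/normal_const_gt0.
  rewrite /G /g -expR_sum ler_expR sumrN lerN2 -!mulr_suml ler_pM2r//.
  apply: le_trans (CP _); rewrite norm2E.
  rewrite [in leRHS](eq_bigr (fun i => tnth t i ^+ 2)%R)//.
  by move=> i _; rewrite mxE.
under eq_integral do rewrite EFinM.
rewrite ge0_integralZl_EFin//.
- by apply: lte_mul_pinfty => //; rewrite lee_fin; exact/ltW/normal_const_gt0.
- by move=> t _; rewrite lee_fin.
- exact/measurable_EFinP.
- exact/ltW/normal_const_gt0.
Qed.

Lemma normal_tuple_opp S D : measurable D ->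
  normal_tuple S (@tuple_opp R d @^-1` D) = normal_tuple S D.
Proof.
move=> mD; apply: ge0_integral_tuple_opp => //.
- exact: measurable_normal_tuple_pdf.
- exact: normal_tuple_pdf_ge0.
move=> t; rewrite !normal_tuple_pdfE row_of_tuple_opp.
by rewrite qformN.
Qed.

Lemma normal_tuple_setU S D E : measurable D -> measurable E -> [disjoint D & E] ->
  normal_tuple S (D `|` E) = normal_tuple S D + normal_tuple S E.
Proof.
move=> mD mE DE; rewrite /normal_tuple ge0_integral_setU//.
- apply/measurable_EFinP/measurable_funTS; exact: measurable_normal_tuple_pdf.
- by move=> t _; rewrite lee_fin normal_tuple_pdf_ge0.
Qed.

(** The difference of the densities is positive on a set of positive measure, so its integral cannot
    vanish. *)
Lemma normal_tuple_lt_neq S S' D : spd S -> spd S' -> measurable D ->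
  0 < lebesgue_tuple d D ->
  (forall t, D t -> normal_tuple_pdf S t < normal_tuple_pdf S' t)%R ->
  normal_tuple S D <> normal_tuple S' D.
Proof.
move=> hS hS' mD D0 lt12 e12.
have int (T : 'M[R]_d) : spd T ->
    (lebesgue_tuple d).-integrable D (EFin \o normal_tuple_pdf T).
  move=> hT; apply/integrableP; split.
    apply/measurable_EFinP/measurable_funTS; exact: measurable_normal_tuple_pdf.
  rewrite (eq_integral (EFin \o normal_tuple_pdf T)).
    exact: normal_tuple_lty.
  move=> t _; apply: gee0_abs; rewrite lee_fin.
  exact: normal_tuple_pdf_ge0.
have := @integral_gt0_neq0 R d D
  (fun t => normal_tuple_pdf S' t - normal_tuple_pdf S t)%R mD D0.
have -> : \int[lebesgue_tuple d]_(t in D)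
    (normal_tuple_pdf S' t - normal_tuple_pdf S t)%:E = 0.
  under eq_integral do rewrite EFinB.
  rewrite (integralB_EFin mD (int _ hS') (int _ hS)).
  move: e12 (normal_tuple_lty hS mD); rewrite /normal_tuple => -> lty.
  apply: subee; rewrite ge0_fin_numE//; apply: integral_ge0 => t _.
  by rewrite lee_fin; exact: normal_tuple_pdf_ge0.
rewrite eqxx => h; suff : false by []; apply: h.
  apply: measurable_funB; apply/measurable_funTS;
    exact: measurable_normal_tuple_pdf.
by move=> t Dt; rewrite subr_gt0 lt12.
Qed.

End gaussian_law.

(** * Measurability and continuity of the wrapping map *)

Section borel.
Context {R : realType} {d : nat}.
Local Notation RT := (measurableTypeR R).
Local Notation ambient := (@ambient R d).
Implicit Types (mu nu : 'rV[R]_d.+1) (t : d.-tuple RT) (z : 'rV[R]_d).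

Lemma measurable_coord i :
  measurable_fun [set: ambient] (fun x : ambient => (x : 'rV[R]_d.+1) 0 i).
Proof.
apply: (measurability _ (RGenOpens.measurableE R)) => _ [_ [a [b ->]] <-].
rewrite setTI; apply: sub_sigma_algebra.
by apply: open_comp => // x _; exact: coord_continuous.
Qed.

Lemma measurable_lorentzl nu :
  measurable_fun [set: ambient] (fun x : ambient => lorentz nu x).
Proof.
apply: measurable_funD.
  by apply: measurable_funN; apply: measurable_funM => //; exact: measurable_coord.
by apply: measurable_sum => j; apply: measurable_funM => //; exact: measurable_coord.
Qed.

Lemma measurable_unwrap mu j :
  measurable_fun [set: ambient] (fun x : ambient => unwrap mu x 0 j).
Proof.
pose f (x : ambient) : R := (x : 'rV[R]_d.+1) 0 (lift ord0 j) +
  lorentz mu x * mu 0 (lift ord0 j) +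
  lorentz origin (x + lorentz mu x *: mu) / (1 - lorentz mu origin) *
  (mu + origin) 0 (lift ord0 j).
rewrite (_ : (fun x => _) = f); last first.
  by apply/funext => x; rewrite /unwrap /transport /f 3!mxE [X in _ + X]mxE !mxE.
have mp i : measurable_fun [set: ambient]
    (fun x : ambient => (x : 'rV[R]_d.+1) 0 i + lorentz mu x * mu 0 i).
  apply: measurable_funD; first exact: measurable_coord.
  by apply: measurable_funM => //; exact: measurable_lorentzl.
apply: measurable_funD; first exact: mp.
apply: measurable_funM => //; apply: measurable_funM => //.
rewrite (_ : (fun x => _) = fun x : ambient =>
    - ((x : 'rV[R]_d.+1) 0 ord0 + lorentz mu x * mu 0 ord0)).
  by apply: measurable_funN; exact: mp.
by apply/funext => x; rewrite lorentz_originl !mxE.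
Qed.

Lemma measurable_hyperboloid : measurable (hyperboloid : set ambient).
Proof.
rewrite (_ : hyperboloid = (fun x : ambient => lorentz x x) @^-1` [set -1] `&`
   (fun x : ambient => (x : 'rV[R]_d.+1) 0 ord0) @^-1` `]0, +oo[); last first.
  by apply/seteqP; split => x /= [h1 h2]; split=> //;
     rewrite ?in_itv/= ?andbT// in h2 *.
apply: measurableI; rewrite -[X in measurable X]setTI.
  apply: measurable_funD => //.
    by apply: measurable_funN; apply: measurable_funM; exact: measurable_coord.
  by apply: measurable_sum => j; apply: measurable_funM; exact: measurable_coord.
exact: measurable_coord.
Qed.

(** The laws are compared only on Borel subsets of the hyperboloid; the intersection disappears
    upstairs because [wrap] takes its values there. *)
Lemma HWN_sublevel mu (Sigma : 'M[R]_d) (f : ambient -> R) c : hyperboloid mu ->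
  HWN mu Sigma (hyperboloid `&` [set x | f x < c]) =
  normal_tuple Sigma [set t | f (wrap mu (row_of_tuple t)) < c].
Proof.
move=> hmu; rewrite HWNE//; congr normal_tuple; apply/seteqP; split => t /=.
  by case.
by move=> h; split=> //; exact: wrap_hyperboloid.
Qed.

Lemma measurable_sublevel (f : ambient -> R) c : measurable_fun setT f ->
  measurable (hyperboloid `&` [set x | f x < c] : set ambient).
Proof.
move=> mf; apply: measurableI; first exact: measurable_hyperboloid.
rewrite -preimage_itvNyo -[X in measurable X]setTI; exact: mf.
Qed.

Lemma measurable_norm : measurable_fun setT (fun t => norm (row_of_tuple t)).
Proof.
rewrite (_ : (fun t => _) = (@powR R ^~ 2^-1) \o
    (fun t => \sum_j row_of_tuple t 0 j ^+ 2)); last first.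
  by apply/funext => t; rewrite /= /norm norm2E powR12_sqrt// sumr_ge0// => j _;
     exact: sqr_ge0.
apply: measurableT_comp; first exact: measurable_powR.
apply: measurable_sum => j; apply: measurable_funX.
exact: measurable_row_of_tuple.
Qed.

Lemma measurable_cosh : measurable_fun setT (@cosh R).
Proof.
apply: measurable_funM => //; apply: measurable_funD => //.
exact: measurableT_comp.
Qed.

Lemma measurable_sinhc : measurable_fun setT (fun x : R => sinh x / x).
Proof.
(* Writing [x^-1] as [x * (x^2)^-1], valid also at 0, reduces inversion to a real power of a
   nonnegative number. *)
rewrite (_ : (fun x => _) = fun x => sinh x * (x * (x ^+ 2) `^ (-1))).
  apply: measurable_funM.
    apply: measurable_funM => //; apply: measurable_funB => //.
    exact: measurableT_comp.
  apply: measurable_funM => //.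
  apply: (measurableT_comp (measurable_powR _)); exact: measurable_funX.
apply/funext => x; rewrite powR_inv1 ?sqr_ge0//; congr (_ * _).
have [->|x0] := eqVneq x 0; first by rewrite invr0 mul0r.
by rewrite expr2 invfM mulrA divff// mul1r.
Qed.

(** Isolates the dependence on [z] in [norm z] and one linear functional, from which measurability
    and continuity are read off. *)
Lemma lorentz_wrapE mu nu : exists c : 'I_d -> R, forall z,
  lorentz nu (wrap mu z) = cosh (norm z) * lorentz nu mu +
    sinh (norm z) / norm z * \sum_j c j * z 0 j.
Proof.
pose b := lorentz nu (origin + mu) / (1 - lorentz origin mu).
exists (fun j => nu 0 (lift ord0 j) + b * mu 0 (lift ord0 j)) => z.
rewrite /wrap lorentzDr !lorentzZr; congr (_ + _ * _).
rewrite /transport lorentzDr lorentzZr !lorentz_embedr.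
rewrite (_ : _ / _ * _ = b * \sum_j mu 0 (lift ord0 j) * z 0 j); last first.
  by rewrite /b; ring.
rewrite mulr_sumr -big_split; apply: eq_bigr => j _ /=; ring.
Qed.

Lemma measurable_lorentz_wrap mu nu :
  measurable_fun setT (fun t => lorentz nu (wrap mu (row_of_tuple t))).
Proof.
have [c cE] := lorentz_wrapE mu nu; under eq_fun do rewrite cE.
apply: measurable_funD.
  apply: measurable_funM => //.
  exact: (measurableT_comp measurable_cosh measurable_norm).
apply: measurable_funM.
  exact: (measurableT_comp measurable_sinhc measurable_norm).
apply: measurable_sum => j; apply: measurable_funM => //.
exact: measurable_row_of_tuple.
Qed.

Lemma continuous_sumr (T : topologicalType) n (f : 'I_n -> T -> R) x :
  (forall i, {for x, continuous (f i)}) ->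
  {for x, continuous (fun y => \sum_i f i y)}.
Proof.
by move=> cf; apply: cvg_big => [|i _]; [exact: add_continuous|exact: cf].
Qed.

Lemma continuous_norm : continuous (@norm R d).
Proof.
move=> z; rewrite (_ : norm = Num.sqrt \o (fun z => \sum_j z 0 j ^+ 2)); last first.
  by apply/funext => x; rewrite /norm norm2E.
apply: continuous_comp; last exact: sqrt_continuous.
apply: continuous_sumr => j.
apply: (@continuous_comp _ _ _ (fun x : 'rV[R]_d => x 0 j) (fun y => y ^+ 2)).
  exact: coord_continuous.
exact: exprn_continuous.
Qed.

Lemma continuous_qform (A : 'M[R]_d) : continuous (qform A).
Proof.
move=> z; rewrite (_ : qform A =
    fun z => \sum_j (\sum_i z 0 i * A i j) * z 0 j); last first.
  by apply/funext => x; rewrite qformE.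
apply: continuous_sumr => j.
have h : {for z, continuous (fun x : 'rV[R]_d => \sum_i x 0 i * A i j)}.
  apply: continuous_sumr => i.
  by apply: continuousM; [exact: coord_continuous|exact: cst_continuous].
apply: continuousM; first exact: h. 
exact: coord_continuous.
Qed.

Lemma continuous_cosh : continuous (@cosh R).
Proof.
move=> x; apply: cvgMl; apply: cvgD; first exact: continuous_expR.
by apply: continuous_comp; [exact: oppr_continuous|exact: continuous_expR].
Qed.

Lemma continuous_sinh : continuous (@sinh R).
Proof.
move=> x; apply: cvgMl; apply: cvgB; first exact: continuous_expR.
by apply: continuous_comp; [exact: oppr_continuous|exact: continuous_expR].
Qed.

(** Away from 0 each factor is continuous; at 0 the factor [sinh r / r] takes the default value 0
    instead of its limit 1. *)
Lemma continuous_lorentz_wrap mu nu z : z != 0 ->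
  {for z, continuous (fun z => lorentz nu (wrap mu z))}.
Proof.
move=> z0; have [c cE] := lorentz_wrapE mu nu.
rewrite (_ : (fun z => _) = fun z => cosh (norm z) * lorentz nu mu +
    sinh (norm z) / norm z * \sum_j c j * z 0 j); last exact/funext.
have nz := @continuous_norm z.
have h1 : {for z, continuous (fun x : 'rV[R]_d => cosh (norm x))}.
  by apply: (continuous_comp (g := cosh)) => //; exact: continuous_cosh.
have h2 : {for z, continuous (fun x : 'rV[R]_d => sinh (norm x))}.
  by apply: (continuous_comp (g := sinh)) => //; exact: continuous_sinh.
have h3 : {for z, continuous (fun x : 'rV[R]_d => (norm x)^-1)}.
  by apply: continuousV => //; apply: contra_neq z0; exact: norm_eq0.
have h4 : {for z, continuous (fun x : 'rV[R]_d => \sum_j c j * x 0 j)}.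
  apply: continuous_sumr => j.
  by apply: continuousM; [exact: cst_continuous|exact: coord_continuous].
apply: continuousD; last by apply: continuousM h4; apply: continuousM h3.
by apply: continuousM; [exact: h1|exact: cst_continuous].
Qed.

End borel.

(** * Identifiability *)

Section identifiability.
Context {R : realType} {d : nat}.
Local Notation RT := (measurableTypeR R).
Implicit Types (mu nu : 'rV[R]_d.+1) (S : 'M[R]_d).

Lemma HWN_reflect mu S nu c : hyperboloid mu ->
  HWN mu S (hyperboloid `&` [set x | lorentz (reflect mu nu) x < c]) =
  HWN mu S (hyperboloid `&` [set x | lorentz nu x < c]).
Proof.
move=> hmu; rewrite (HWN_sublevel _ (lorentz (reflect mu nu)))//.
rewrite (HWN_sublevel _ (lorentz nu))//.
rewrite -[RHS]normal_tuple_opp; last first.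
  rewrite -preimage_itvNyo -[X in measurable X]setTI.
  exact: measurable_lorentz_wrap.
congr normal_tuple; apply/seteqP.
by split => t /=; rewrite row_of_tuple_opp wrapN// -lorentz_reflect.
Qed.

(** The slab between the two levels contains a neighbourhood of [z], so it has positive mass, and
    the finite mass below level [a] cancels. *)
Lemma normal_tuple_sublevel_neq S (f : 'rV[R]_d -> R) (z : 'rV[R]_d) a b :
  spd S -> measurable_fun setT (fun t : d.-tuple RT => f (row_of_tuple t)) ->
  {for z, continuous f} -> a < f z < b ->
  normal_tuple S [set t | f (row_of_tuple t) < a] <>
  normal_tuple S [set t | f (row_of_tuple t) < b].
Proof.
move=> hS mf cf /andP[az zb].
have mA : measurable [set t : d.-tuple RT | f (row_of_tuple t) < a].
  by rewrite -preimage_itvNyo -[X in measurable X]setTI; exact: mf.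
pose D := [set t : d.-tuple RT | a <= f (row_of_tuple t) < b].
have mD : measurable D.
  rewrite (_ : D = (fun t : d.-tuple RT => f (row_of_tuple t)) @^-1` `[a, b[).
    by rewrite -[X in measurable X]setTI; exact: mf.
  by apply/seteqP; split=> t /=; rewrite in_itv.
have -> : [set t : d.-tuple RT | f (row_of_tuple t) < b] =
    [set t | f (row_of_tuple t) < a] `|` D.
  apply/seteqP; split => t /=.
    move=> tb; have [ta|ta] := ltP (f (row_of_tuple t)) a; first by left.
    by right; apply/andP.
  by case=> [/lt_trans|/andP[]//]; apply; exact: lt_trans zb.
rewrite normal_tuple_setU//; last first.
  by apply/disj_setPS => t [/= ta /andP[]]; rewrite leNgt ta.
have fin : normal_tuple S [set t | f (row_of_tuple t) < a] \is a fin_num.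
  rewrite ge0_fin_numE ?normal_tuple_lty//; apply: integral_ge0 => t _.
  by rewrite lee_fin; exact: normal_tuple_pdf_ge0.
have addeI0 (x y : \bar R) : (x \is a fin_num -> x = x + y -> y = 0)%E.
  by move: x y => [x| |] [y| |]//= _ [xy]; congr EFin; lra.
move=> /(addeI0 _ _ fin).
apply/eqP/integral_gt0_neq0 => //.
- apply: (nbhs_row_of_tuple_gt0 (a := z) (P := [set x | a < f x < b])) => //.
    have ha : \forall x \near z, a < f x by exact: (cvgr_gt _ cf).
    have hb : \forall x \near z, f x < b by exact: (cvgr_lt _ cf).
    by apply: filterS (filterI ha hb) => x [ax xb]; exact/andP.
  by move=> t /= /andP[ta tb]; rewrite /D/= ltW.
- by apply/measurable_funTS; exact: measurable_normal_tuple_pdf.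
- by move=> t _; exact: normal_tuple_pdf_gt0.
Qed.

(** * Recovering the centre *)

Section same_law.
Variables (mu mu' : 'rV[R]_d.+1) (S S' : 'M[R]_d).
Hypotheses (hmu : hyperboloid mu) (hmu' : hyperboloid mu').
Hypotheses (hS : spd S) (hS' : spd S').
Hypothesis hlaw : forall B : set (@ambient R d),
  measurable B -> B `<=` hyperboloid -> HWN mu S B = HWN mu' S' B.

Lemma HWN_center : (0 < d)%N -> mu = mu'.
Proof.
move=> d0; apply/eqP; apply: contraT => neq; exfalso.
have [n [c [/andP[c0 c1] nn n0 nc]]] := reflect_null hmu hmu' neq.
have law nu e : HWN mu S (hyperboloid `&` [set x | lorentz nu x < e]) =
    HWN mu' S' (hyperboloid `&` [set x | lorentz nu x < e]).
  apply: hlaw; last by move=> x [].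
  by apply: (measurable_sublevel (f := lorentz nu)); exact: measurable_lorentzl.
have scale e : HWN mu S (hyperboloid `&` [set x | lorentz n x < e]) =
    HWN mu S (hyperboloid `&` [set x | lorentz n x < e / c]).
  (* Reflect in [mu] under the first law, pass to the second law, reflect in [mu'], and return: [n]
     has become [c n], so the level [e] becomes [e / c]. *)
  rewrite -(HWN_reflect S n e hmu) law.
  rewrite -(HWN_reflect S' (reflect mu n) e hmu') nc -law.
  congr (HWN mu S (hyperboloid `&` _)); apply/seteqP.
  by split=> x /=; rewrite lorentzZl ltr_pdivlMr// mulrC.
pose z : 'rV[R]_d := const_mx 1.
have z0 : z != 0.
  apply: contraT; rewrite negbK => /eqP/rowP/(_ (Ordinal d0)).
  by rewrite !mxE => /eqP; rewrite oner_eq0.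
set p := lorentz n (wrap mu z).
have p0 : p != 0.
  apply: contra_neq (null_lorentz_neq0 (wrap_hyperboloid hmu z) nn n0).
  by rewrite lorentzC.
(* As [(1 + c) / 2 < 1 < (1 + c) / (2 c)], the level and its quotient by [c] lie strictly on either
   side of [p], in the order given by the sign of [p]. *)
have := scale ((1 + c) / 2 * p).
rewrite !(HWN_sublevel _ (lorentz n))//.
have cf := continuous_lorentz_wrap (mu := mu) (nu := n) z0.
have mf := measurable_lorentz_wrap mu n.
have H a b := @normal_tuple_sublevel_neq S
  (fun x => lorentz n (wrap mu x)) z a b hS mf cf.
have [pn|pp|pE] := ltgtP p 0; last by rewrite pE eqxx in p0.
- move=> /esym; apply: H; rewrite -/p; apply/andP; split.
    by rewrite ltr_pdivrMr//; nra.
  by nra.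
- apply: H; rewrite -/p; apply/andP; split; first by nra.
  by rewrite ltr_pdivlMr//; nra.
Qed.

End same_law.

(** * Recovering the covariance *)

Section same_center.
Variables (mu : 'rV[R]_d.+1) (S S' : 'M[R]_d).
Hypotheses (hmu : hyperboloid mu) (hS : spd S) (hS' : spd S').
Hypothesis hlaw : forall B : set (@ambient R d),
  measurable B -> B `<=` hyperboloid -> HWN mu S B = HWN mu S' B.

Lemma HWN_normal_const_le : normal_const S <= normal_const S'.
Proof.
rewrite leNgt; apply/negP => KK.
have K0 := normal_const_gt0 hS; have K0' := normal_const_gt0 hS'.
have [C C0 CP] := qform_le (invmx S).
have [C' C0' CP'] := spd_invmx_ge hS'.
pose l := ln (normal_const S / normal_const S').
have l0 : 0 < l by rewrite ln_gt0// ltr_pdivlMr// mul1r.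
(* Chosen so that [C r^2 / 2 = l]: inside radius [r] the exponential factor of the [S] density stays
   above the ratio of the constants, and so that density exceeds the maximum of the other. *)
pose r := Num.sqrt (2 * l / C).
have r0 : 0 < r by rewrite sqrtr_gt0 divr_gt0// mulr_gt0.
have r2 : r ^+ 2 = 2 * l / C by rewrite sqr_sqrtr// ltW// divr_gt0// mulr_gt0.
(* On the hyperboloid this is the [cosh] of the distance to [mu], so its sublevel sets pull back to
   Euclidean balls around 0. *)
pose f (x : @ambient R d) := - lorentz mu x.
have mf : measurable_fun setT f.
  by apply: measurable_funN; exact: measurable_lorentzl.
pose D := [set t : d.-tuple RT | f (wrap mu (row_of_tuple t)) < cosh r].
have DE t : D t = (norm (row_of_tuple t) < r) :> Prop.
  by rewrite /D /f/= lorentz_wrap// opprK ltr_cosh ?norm_ge0// ltW.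
have mD : measurable D.
  rewrite /D -preimage_itvNyo -[X in measurable X]setTI.
  by apply: measurable_funN => //; exact: measurable_lorentz_wrap.
apply: (normal_tuple_lt_neq hS' hS mD).
- apply: (nbhs_row_of_tuple_gt0 (a := 0) (P := [set x | norm x < r])) => //.
    have nr : norm (0 : 'rV[R]_d) < r.
      by rewrite /norm norm2E big1 ?sqrtr0// => j _; rewrite mxE expr0n.
    have c0 : {for 0, continuous (@norm R d)} by exact: continuous_norm.
    have h : \forall x \near (0 : 'rV[R]_d), norm x < r by exact: (cvgr_lt _ c0).
    exact: h.
  by move=> t; rewrite DE.
- move=> t; rewrite DE !normal_tuple_pdfE.
  set z := row_of_tuple t => zr.
  apply: (@le_lt_trans _ _ (normal_const S')).
    rewrite -[leRHS]mulr1 ler_wpM2l ?(ltW K0')// -expR0 ler_expR.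
    rewrite oppr_le0 divr_ge0//; apply: le_trans (CP' z).
    by rewrite divr_ge0 ?norm2_ge0// ltW.
  rewrite -ltr_pdivrMl// mulrC.
  have KK0 : 0 < normal_const S' / normal_const S by rewrite divr_gt0.
  rewrite -[ltLHS]lnK ?posrE// ltr_expR -[_ / _]invf_div lnV ?posrE ?divr_gt0//.
  rewrite -/l ltrN2.
  have : norm z ^+ 2 < r ^+ 2 by rewrite ltr_pXn2r// ?nnegrE ?norm_ge0// ltW.
  rewrite sqr_norm r2 ltr_pdivlMr// => h.
  by have := CP z; lra.
- rewrite -(HWN_sublevel S' f (cosh r) hmu) -(HWN_sublevel S f (cosh r) hmu).
  by apply/esym/hlaw; [exact: measurable_sublevel|exact: subIsetl].
Qed.

Lemma HWN_qform_ge z : normal_const S = normal_const S' ->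
  qform (invmx S') z <= qform (invmx S) z.
Proof.
move=> KK; rewrite leNgt; apply/negP => ltz.
pose q := qform (invmx S - invmx S').
have qz : q z < 0 by rewrite /q qformB subr_lt0.
pose f (x : @ambient R d) := q (unwrap mu x).
have mf : measurable_fun setT f.
  rewrite /f /q; under eq_fun do rewrite qformE.
  apply: measurable_sum => j; apply: measurable_funM; last exact: measurable_unwrap.
  apply: measurable_sum => i; apply: measurable_funM => //.
  exact: measurable_unwrap.
pose D := [set t : d.-tuple RT | f (wrap mu (row_of_tuple t)) < 0].
have DE : D = [set t | q (row_of_tuple t) < 0].
  (* [unwrap] returns a multiple of the row whose factor is nonzero away from 0; a quadratic form
     keeps its sign under such scaling, and [q] vanishes at 0. *)
  apply/seteqP; split=> t; rewrite /D/= /f unwrap_wrap// /q qformZ.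
    by apply: contraTT; rewrite -!leNgt => qt; rewrite mulr_ge0// sqr_ge0.
  move=> qt; rewrite pmulr_rlt0// exprn_even_gt0//=.
  have x0 : 0 < norm (row_of_tuple t).
    rewrite lt_neqAle norm_ge0 andbT eq_sym; apply: contraTneq qt.
    by move=> /norm_eq0 ->; rewrite qform0 ltxx.
  by rewrite mulf_neq0 ?invr_neq0 ?gt_eqF ?sinh_gt0.
have mD : measurable D.
  rewrite DE -preimage_itvNyo -[X in measurable X]setTI.
  exact: measurable_qform.
apply: (normal_tuple_lt_neq hS' hS mD).
- apply: (nbhs_row_of_tuple_gt0 (a := z) (P := [set x | q x < 0])) => //.
    have cz : {for z, continuous q} by exact: continuous_qform.
    have h : \forall x \near z, q x < 0 by exact: (cvgr_lt _ cz).
    exact: h.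
  by move=> t; rewrite DE.
- move=> t; rewrite DE/= /q qformB subr_lt0 => lt12.
  rewrite !normal_tuple_pdfE KK ltr_pM2l ?normal_const_gt0// ltr_expR ltrN2.
  by rewrite ltr_pM2r.
- rewrite -(HWN_sublevel S' f 0 hmu) -(HWN_sublevel S f 0 hmu).
  by apply/esym/hlaw; [exact: measurable_sublevel|exact: subIsetl].
Qed.

End same_center.

Lemma HWN_covariance mu S S' : hyperboloid mu -> spd S -> spd S' ->
  (forall B : set (@ambient R d), measurable B -> B `<=` hyperboloid ->
    HWN mu S B = HWN mu S' B) -> S = S'.
Proof.
move=> hmu hS hS' hlaw.
have hlaw' B mB BH := esym (hlaw B mB BH).
have KK : normal_const S = normal_const S'.
  by apply/le_anti; rewrite !(@HWN_normal_const_le mu).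
apply: (can_inj (@invmxK _ _)); apply: qform_inj; rewrite ?spd_invmx_sym//.
move=> z; apply/le_anti; rewrite (HWN_qform_ge hmu hS' hS hlaw' z (esym KK)).
exact: (HWN_qform_ge hmu hS hS' hlaw).
Qed.

End identifiability.

Theorem theorem4p2 (R : realType) (d : nat) (hd : (2 <= d)%N)
    (mu mu' : 'rV[R]_d.+1) (Sigma Sigma' : 'M[R]_d)
    (hmu : hyperboloid mu) (hmu' : hyperboloid mu')
    (hSigma : spd Sigma) (hSigma' : spd Sigma')
    (hlaw : forall B : set (@ambient R d),
      measurable B -> B `<=` hyperboloid -> HWN mu Sigma B = HWN mu' Sigma' B) :
  mu = mu' /\ Sigma = Sigma'.
Proof.
have E := HWN_center hmu hmu' hSigma hlaw (ltnW hd).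
by subst mu'; split=> //; exact: (HWN_covariance hmu hSigma hSigma' hlaw).
Qed.
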